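(* Let $g(x)=e^{x+1}\int_{x+1}^{\infty}\frac{e^{-y}}{y}\,dy$ for $x\ge 0$. There is an absolute constant $C>0$ such that, on every instance of the online stochastic rewards problem, the expected total reward of Algorithm 2 (Generalized Fully-Adaptive) run with this $g$ is at least $(1-C\sqrt{p_{\max}})\,g(0)$ times the optimal expected reward of any fully offline policy (and hence of any clairvoyant policy), where $p_{\max}=\max_{(i,t)\in E}p_{it}$. Moreover $g(0)>0.596$.
   Context: Online stochastic rewards problem: a bipartite graph $G=(I,T,E)$; offline vertices (resources) $i\in I$ are known in advance, each has a reward $r_i>0$ and unit capacity. Online vertices (arrivals) $t\in T$ arrive one at a time in the order $t=1,2,\dots$; when $t$ arrives, its incident edges $(i,t)\in E$ and their success probabilities $p_{it}\in[0,1]$ are revealed. The algorithm must then irrevocably offer $t$ at most one currently available neighbour $i$. The offer succeeds with probability $p_{it}$, independently of everything else; if it succeeds the algorithm earns $r_i$ and $i$ becomes unavailable forever, otherwise $i$ stays available. The outcome is revealed only after the offer is made. The goal is to maximize expected total reward. Benchmarks: a clairvoyant policy knows $G$, all $p_{it}$ and $r_i$ in advance, processes arrivals in the order $1,2,\dots$, offers each arrival at most one available resource, and learns the outcome of each offer only after making it. A fully offline policy has the same knowledge and constraints but may adaptively choose the order in which arrivals are processed. Algorithm 2 (Generalized Fully-Adaptive) with scaling function $g:[0,\infty)\to[0,1]$: initially all resources are available and $l_i=0$ for all $i$. When $t$ arrives, offer $t$ the available neighbour $i^*$ maximizing $p_{it}r_ig(l_i)$ (if any); if $t$ accepts, $i^*$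 becomes unavailable; otherwise set $l_{i^*}\leftarrow l_{i^*}+p_{i^*t}$. *)

(* Defs.v *)
From Stdlib Require Import Reals Lra Lia List.
Open Scope R_scope.

Definition improper_integral (f : R -> R) (a l : R) : Prop :=
  (forall b, a <= b -> inhabited (Riemann_integrable f a b)) /\
  (forall eps, 0 < eps -> exists B, forall b (pr : Riemann_integrable f a b),
      a <= b -> B <= b -> Rabs (RiemannInt pr - l) < eps).

(** An instance of the online stochastic rewards problem.
    Resources are 0..nI-1, arrivals are 0..nT-1 (arriving in this order). *)
Record instance := Instance {
  nI : nat;
  nT : nat;
  E : nat -> nat -> bool;
  p : nat -> nat -> R;
  r : nat -> R
}.

Definition wf_instance (I : instance) : Prop :=
  (forall i, (i < nI I)%nat -> 0 < r I i) /\
  (forall i t, (i < nI I)%nat -> (t < nT I)%nat -> E I i t = true ->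
     0 <= p I i t <= 1).

(** p_max = max over edges of p_it (0 if there are no edges). *)
Definition pmax (I : instance) : R :=
  fold_right Rmax 0
    (flat_map (fun i => map (fun t => p I i t)
                  (filter (fun t => E I i t) (seq 0 (nT I))))
              (seq 0 (nI I))).

Definition updb (f : nat -> bool) (k : nat) (b : bool) : nat -> bool :=
  fun j => if Nat.eqb j k then b else f j.
Definition updr (f : nat -> R) (k : nat) (x : R) : nat -> R :=
  fun j => if Nat.eqb j k then x else f j.

(** Algorithm 2 (Generalized Fully-Adaptive) with scaling function g.
    [alg_val g I t avail l v] : starting at arrival t with availability
    [avail] and load vector [l], the expected reward collected from arrival t
    onwards is v, for some (arbitrary, possibly history dependent)
    tie-breaking among maximizers. *)
Inductive alg_val (g : R -> R) (I : instance) :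
    nat -> (nat -> bool) -> (nat -> R) -> R -> Prop :=
| av_end : forall t avail l, (nT I <= t)%nat -> alg_val g I t avail l 0
| av_none : forall t avail l v, (t < nT I)%nat ->
    (forall i, (i < nI I)%nat -> avail i = true -> E I i t = false) ->
    alg_val g I (S t) avail l v -> alg_val g I t avail l v
| av_offer : forall t avail l i vs vf, (t < nT I)%nat ->
    (i < nI I)%nat -> avail i = true -> E I i t = true ->
    (forall j, (j < nI I)%nat -> avail j = true -> E I j t = true ->
        p I j t * r I j * g (l j) <= p I i t * r I i * g (l i)) ->
    alg_val g I (S t) (updb avail i false) l vs ->
    alg_val g I (S t) avail (updr l i (l i + p I i t)) vf ->
    alg_val g I t avail l (p I i t * (r I i + vs) + (1 - p I i t) * vf).

(** Fully offline (adaptive) policies as decision trees: at each step pick an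
    unprocessed arrival t and either process it without an offer (Skip) or
    offer it one available neighbour i; the continuation depends on the
    outcome (success / failure). *)
Inductive policy :=
| Stop : policy
| Skip : nat -> policy -> policy
| Offer : nat -> nat -> policy -> policy -> policy.

Fixpoint valid (I : instance) (pol : policy) (done avail : nat -> bool) : Prop :=
  match pol with
  | Stop => True
  | Skip t k => (t < nT I)%nat /\ done t = false /\ valid I k (updb done t true) avail
  | Offer t i ks kf =>
      (t < nT I)%nat /\ done t = false /\ (i < nI I)%nat /\ avail i = true /\
      E I i t = true /\
      valid I ks (updb done t true) (updb avail i false) /\
      valid I kf (updb done t true) avail
  end.

Fixpoint pval (I : instance) (pol : policy) : R :=
  match pol with
  | Stop => 0
  | Skip _ k => pval I k
  | Offer t i ks kf => p I i t * (r I i + pval I ks) + (1 - p I i t) * pval I kf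
  end.

(* Main.v *)
Require Import Defs.
From Coquelicot Require Import Coquelicot.
From Stdlib Require Import Reals Lra Lia List FunctionalExtensionality.
Open Scope R_scope.

(* Give each resource i a uniform seed u_i in (0,1] and let an offer of i fail exactly when u_i
   is at most the product of (1 - p) over all offers of i made so far, this one included. The
   algorithm and the offline policy are run on the same seeds. Each offer (i,t) of the algorithm
   pays p r g(l_i) to the arrival t and p r (1 - g(l_i)) to the resource i; the offline policy is
   charged to these payments resource by resource.
   Fix i and all the other seeds. Let V and L be the survival probability and the load of i in
   the run of the algorithm where i is never taken. If u_i <= V, then i was available throughout,
   so greediness gives every arrival t adjacent to i a payment of at least p_it r_i g(L).
   If u_i > V, only the payments to i are used. In the limit of small p, where V = exp (-L), the
   resource collects at least r_i times
     int_0^L (1 - g x) exp (-x) dx + exp (-L) g(L) (L + 1) = g(0),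
   against an offline policy that offers i until it is taken; the identity is the differential
   equation g' = g - 1/(x+1). Offline policies that stop earlier only leave more slack. For
   positive p the error is O(pmax (1 - V)), and a resource with a large 1 - V pays enough by
   itself, so that the loss is a factor 1 - O(pmax). *)

(** * The scaling function *)

Local Notation ef := (fun y : R => exp (- y) / y) (only parsing).

Lemma exp_neg_le_inv (b : R) : 0 < b -> exp (- b) < / b.
Proof.
  intros Hb. rewrite exp_Ropp. apply Rinv_lt_contravar.
  - apply Rmult_lt_0_compat; [lra|apply exp_pos].
  - generalize (exp_ineq1 b). lra.
Qed.

Lemma continuous_ef (y : R) : 0 < y -> continuous ef y.
Proof.
  intros Hy. apply (ex_derive_continuous (K := R_AbsRing) (V := R_NormedModule)).
  auto_derive. lra.
Qed.

Lemma ex_RInt_ef (a b : R) : 0 < a -> a <= b -> ex_RInt ef a b.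
Proof.
  intros Ha Hab. apply (ex_RInt_continuous (V := R_CompleteNormedModule)).
  intros z Hz. rewrite Rmin_left, Rmax_right in Hz by lra.
  apply continuous_ef. lra.
Qed.

Lemma RInt_ge_of_derive (F dF f : R -> R) (a b : R) :
  a <= b -> ex_RInt f a b ->
  (forall y, a <= y <= b -> is_derive F y (dF y)) ->
  (forall y, a <= y <= b -> continuous dF y) ->
  (forall y, a <= y <= b -> dF y <= f y) ->
  F b - F a <= RInt f a b.
Proof.
  intros Hab Hf HF Hc Hle.
  assert (Hi : is_RInt dF a b (minus (F b) (F a))).
  { apply (is_RInt_derive (V := R_CompleteNormedModule)); intros y Hy;
      rewrite Rmin_left, Rmax_right in Hy by lra; auto. }
  replace (F b - F a) with (RInt dF a b)
    by (apply is_RInt_unique; exact Hi).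
  apply RInt_le; auto.
  - eexists; exact Hi.
  - intros y Hy. apply Hle. lra.
Qed.

Lemma RInt_le_of_derive (F dF f : R -> R) (a b : R) :
  a <= b -> ex_RInt f a b ->
  (forall y, a <= y <= b -> is_derive F y (dF y)) ->
  (forall y, a <= y <= b -> continuous dF y) ->
  (forall y, a <= y <= b -> f y <= dF y) ->
  RInt f a b <= F b - F a.
Proof.
  intros Hab Hf HF Hc Hle.
  assert (Hi : is_RInt dF a b (minus (F b) (F a))).
  { apply (is_RInt_derive (V := R_CompleteNormedModule)); intros y Hy;
      rewrite Rmin_left, Rmax_right in Hy by lra; auto. }
  replace (F b - F a) with (RInt dF a b)
    by (apply is_RInt_unique; exact Hi).
  apply RInt_le; auto.
  - eexists; exact Hi.
  - intros y Hy. apply Hle. lra.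
Qed.

Lemma improper_RInt (a l : R) : 0 < a -> improper_integral ef a l ->
  forall eps, 0 < eps -> exists B, forall b, a <= b -> B <= b ->
    Rabs (RInt ef a b - l) < eps.
Proof.
  intros Ha [_ H2] eps He. destruct (H2 eps He) as [B HB].
  exists B. intros b Hab Hb.
  pose (pr := ex_RInt_Reals_0 _ _ _ (ex_RInt_ef a b Ha Hab)).
  rewrite (RInt_Reals _ _ _ pr). apply HB; assumption.
Qed.

Lemma improper_le (a l K : R) : 0 < a -> improper_integral ef a l ->
  (forall b, a <= b -> RInt ef a b <= K) -> l <= K.
Proof.
  intros Ha Hl HK. apply le_epsilon. intros eps He.
  destruct (improper_RInt a l Ha Hl eps He) as [B HB].
  specialize (HB (Rmax a B) (Rmax_l _ _) (Rmax_r _ _)).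
  specialize (HK (Rmax a B) (Rmax_l _ _)).
  apply Rabs_def2 in HB. lra.
Qed.

(** The slack [3 * exp (- b)] leaves room for the boundary value at [b] of an antiderivative; it
    vanishes in the limit. *)
Lemma improper_ge (a l K : R) : 0 < a -> improper_integral ef a l ->
  (forall b, a <= b -> K - 3 * exp (- b) <= RInt ef a b) -> K <= l.
Proof.
  intros Ha Hl HK. apply le_epsilon. intros eps He.
  destruct (improper_RInt a l Ha Hl (eps / 2) ltac:(lra)) as [B HB].
  (* With [6 / eps <= b] one gets [exp (- b) < / b <= eps / 6], so the slack costs at most
     [eps / 2]. *)
  set (b := Rmax (Rmax a B) (6 / eps)).
  assert (Hb1 : a <= b) by (unfold b; eapply Rle_trans; [apply Rmax_l|apply Rmax_l]).
  assert (Hb2 : B <= b).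
  { unfold b; eapply Rle_trans; [|apply Rmax_l]. apply Rmax_r. }
  assert (Hb3 : 6 / eps <= b) by apply Rmax_r.
  specialize (HB b Hb1 Hb2). specialize (HK b Hb1). apply Rabs_def2 in HB.
  assert (exp (- b) <= eps / 6).
  { left. eapply Rlt_le_trans; [apply exp_neg_le_inv; lra|].
    replace (eps / 6) with (/ (6 / eps)) by (field; lra).
    apply Rinv_le_contravar; auto. apply Rdiv_lt_0_compat; lra. }
  lra.
Qed.

Lemma improper_split (a l l' : R) (k : R) : 0 < a ->
  improper_integral ef a l -> improper_integral ef (a + k) l' -> 0 <= k ->
  l = RInt ef a (a + k) + l'.
Proof.
  intros Ha Hl Hl' Hk. apply cond_eq. intros eps He.
  destruct (improper_RInt a l Ha Hl (eps / 2) ltac:(lra)) as [B HB].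
  destruct (improper_RInt (a + k) l' ltac:(lra) Hl' (eps / 2) ltac:(lra)) as [B' HB'].
  set (b := Rmax (a + k) (Rmax B B')).
  assert (a + k <= b) by apply Rmax_l.
  assert (Rmax B B' <= b) by apply Rmax_r.
  generalize (Rmax_l B B') (Rmax_r B B'); intros.
  specialize (HB b ltac:(lra) ltac:(lra)). specialize (HB' b ltac:(lra) ltac:(lra)).
  assert (HC : RInt ef a b = RInt ef a (a + k) + RInt ef (a + k) b).
  { symmetry. apply (RInt_Chasles (V := R_CompleteNormedModule) ef a (a + k) b);
      apply ex_RInt_ef; lra. }
  rewrite HC in HB. apply Rabs_def2 in HB. apply Rabs_def2 in HB'.
  apply Rabs_def1; lra.
Qed.

Lemma RInt_ef_shift (a b k : R) : 0 < a -> a <= b -> 0 <= k ->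
  RInt ef (a + k) (b + k) <= exp (- k) * RInt ef a b.
Proof.
  intros Ha Hab Hk.
  assert (Hex : ex_RInt ef (1 * a + k) (1 * b + k)) by (apply ex_RInt_ef; lra).
  generalize (RInt_comp_lin (V := R_CompleteNormedModule) ef 1 k a b Hex).
  replace (1 * a + k) with (a + k) by ring. replace (1 * b + k) with (b + k) by ring.
  intros <-.
  apply Rle_trans with (RInt (fun y => exp (- k) * ef y) a b).
  2: { right. apply (RInt_scal (V := R_CompleteNormedModule) ef a b (exp (- k))).
       apply ex_RInt_ef; lra. }
  apply RInt_le; auto.
  - apply (ex_RInt_comp_lin ef 1 k a b Hex).
  - apply (ex_RInt_scal (V := R_NormedModule)). apply ex_RInt_ef; lra.
  - intros x Hx. unfold scal; simpl; unfold mult; simpl.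
    replace (- (1 * x + k)) with (- k + - x) by ring. rewrite exp_plus.
    rewrite Rmult_1_l. unfold Rdiv. rewrite Rmult_assoc.
    apply Rmult_le_compat_l; [left; apply exp_pos|].
    apply Rmult_le_compat_l; [left; apply exp_pos|].
    apply Rinv_le_contravar; lra.
Qed.

Lemma RInt_ef_le (a b : R) : 0 < a -> a <= b ->
  RInt ef a b <= (exp (- a) - exp (- b)) / a.
Proof.
  intros Ha Hab.
  replace ((exp (- a) - exp (- b)) / a) with (- exp (- b) / a - (- exp (- a) / a))
    by (field; lra).
  apply RInt_le_of_derive with (F := fun y => - exp (- y) / a)
                               (dF := fun y => exp (- y) / a); auto.
  - apply ex_RInt_ef; lra.
  - intros y Hy. auto_derive; [auto|field; lra].
  - intros y Hy. apply (ex_derive_continuous (K := R_AbsRing) (V := R_NormedModule)).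
    auto_derive. lra.
  - intros y Hy. unfold Rdiv. apply Rmult_le_compat_l; [left; apply exp_pos|].
    apply Rinv_le_contravar; lra.
Qed.

Definition is_scaling (g : R -> R) : Prop :=
  forall x, 0 <= x -> exists Ix,
        improper_integral (fun y => exp (- y) / y) (x + 1) Ix /\
        g x = exp (x + 1) * Ix.

Lemma scaling_nonneg (g : R -> R) (x : R) : is_scaling g -> 0 <= x -> 0 <= g x.
Proof.
  intros Hg Hx. destruct (Hg x Hx) as (Ix & HI & ->).
  apply Rmult_le_pos; [left; apply exp_pos|].
  apply (improper_ge (x + 1) Ix 0 ltac:(lra) HI). intros b Hb.
  apply Rle_trans with 0; [generalize (exp_pos (- b)); lra|].
  apply RInt_ge_0; auto.
  - apply ex_RInt_ef; lra.
  - intros y Hy. apply Rdiv_le_0_compat; [left; apply exp_pos|lra].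
Qed.

Lemma scaling_le_inv (g : R -> R) (x : R) : is_scaling g -> 0 <= x -> g x <= / (x + 1).
Proof.
  intros Hg Hx. destruct (Hg x Hx) as (Ix & HI & ->).
  assert (Ix <= exp (- (x + 1)) / (x + 1)).
  { apply (improper_le (x + 1) Ix _ ltac:(lra) HI). intros b Hb.
    eapply Rle_trans; [apply RInt_ef_le; lra|]. unfold Rdiv.
    apply Rmult_le_compat_r; [left; apply Rinv_0_lt_compat; lra|].
    generalize (exp_pos (- b)); lra. }
  apply Rle_trans with (exp (x + 1) * (exp (- (x + 1)) / (x + 1))).
  - apply Rmult_le_compat_l; [left; apply exp_pos|auto].
  - rewrite exp_Ropp. right. field. split; [lra|]. generalize (exp_pos (x + 1)); lra.
Qed.

(** In the limit, [RInt_ef_shift] bounds the tail from [x + q + 1] by [exp (- q)] times the tail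
    from [x + 1], which cancels the growth [exp q] of the prefactor. *)
Lemma scaling_anti (g : R -> R) (x q : R) :
  is_scaling g -> 0 <= x -> 0 <= q -> g (x + q) <= g x.
Proof.
  intros Hg Hx Hq. destruct (Hg x Hx) as (Ix & HI & ->).
  destruct (Hg (x + q) ltac:(lra)) as (Iq & HIq & ->).
  assert (Iq <= exp (- q) * Ix).
  { replace (x + q + 1) with (x + 1 + q) in HIq by ring.
    apply le_epsilon. intros eps He.
    destruct (improper_RInt (x + 1 + q) _ ltac:(lra) HIq (eps / 2) ltac:(lra)) as [B HB].
    destruct (improper_RInt (x + 1) _ ltac:(lra) HI (eps / 2) ltac:(lra)) as [B' HB'].
    set (b := Rmax (x + 1) (Rmax B B')).
    assert (x + 1 <= b) by apply Rmax_l.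
    assert (Rmax B B' <= b) by apply Rmax_r.
    generalize (Rmax_l B B') (Rmax_r B B'); intros.
    specialize (HB (b + q) ltac:(lra) ltac:(lra)). specialize (HB' b ltac:(lra) ltac:(lra)).
    generalize (RInt_ef_shift (x + 1) b q ltac:(lra) ltac:(lra) Hq).
    apply Rabs_def2 in HB. apply Rabs_def2 in HB'.
    assert (exp (- q) * RInt ef (x + 1) b <= exp (- q) * (Ix + eps / 2))
      by (apply Rmult_le_compat_l; [left; apply exp_pos|lra]).
    assert (exp (- q) <= 1) by (rewrite exp_Ropp, <- Rinv_1; apply Rinv_le_contravar; generalize (exp_ineq1_le q); lra).
    assert (exp (- q) * (eps / 2) <= 1 * (eps / 2)) by (apply Rmult_le_compat_r; lra).
    lra. }
  replace (x + q + 1) with (x + 1 + q) by ring. rewrite exp_plus, Rmult_assoc.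
  apply Rmult_le_compat_l; [left; apply exp_pos|].
  apply Rle_trans with (exp q * (exp (- q) * Ix)).
  - apply Rmult_le_compat_l; [left; apply exp_pos|auto].
  - rewrite <- Rmult_assoc, <- exp_plus. replace (q + - q) with 0 by ring.
    rewrite exp_0. lra.
Qed.

(** A discrete form of [g' = g - 1/(x+1)]: bounding [1/y] by [1/(x+1)] on the removed piece of the
    integral gives the coefficient [exp q - 1], which is at most [q / (1 - q) <= q + 2 * q * q]. *)
Lemma scaling_step (g : R -> R) (x q : R) :
  is_scaling g -> 0 <= x -> 0 <= q <= 1 / 2 ->
  g x - (q + 2 * q * q) * (/ (x + 1) - g x) <= g (x + q).
Proof.
  intros Hg Hx Hq. generalize (scaling_le_inv g x Hg Hx).
  destruct (Hg x Hx) as (Ix & HI & Hgx).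
  destruct (Hg (x + q) ltac:(lra)) as (Iq & HIq & Hgq).
  replace (x + q + 1) with (x + 1 + q) in HIq by ring.
  generalize (improper_split (x + 1) _ _ q ltac:(lra) HI HIq ltac:(lra)).
  generalize (RInt_ef_le (x + 1) (x + 1 + q) ltac:(lra) ltac:(lra)).
  set (J := RInt ef (x + 1) (x + 1 + q)). intros HJ HIJ Hinv.
  assert (Hlow : g (x + q) >= exp q * (g x - exp (x + 1) * ((exp (- (x + 1)) - exp (- (x + 1 + q))) / (x + 1)))).
  { rewrite Hgq, Hgx. replace (x + q + 1) with (q + (x + 1)) by ring.
    rewrite exp_plus, Rmult_assoc, <- Rmult_minus_distr_l.
    apply Rle_ge. apply Rmult_le_compat_l; [left; apply exp_pos|].
    apply Rmult_le_compat_l; [left; apply exp_pos|]. lra. }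
  replace (- (x + 1 + q)) with (- (x + 1) + - q) in Hlow by ring.
  rewrite (exp_plus (- (x + 1)) (- q)), (exp_Ropp (x + 1)), (exp_Ropp q) in Hlow.
  replace (exp q * (g x - exp (x + 1) * ((/ exp (x + 1) - / exp (x + 1) * / exp q) / (x + 1))))
    with (g x - (exp q - 1) * (/ (x + 1) - g x)) in Hlow.
  2:{ field. generalize (exp_pos (x + 1)) (exp_pos q). repeat split; lra. }
  assert (exp q - 1 <= q + 2 * q * q).
  { generalize (exp_ineq1_le (- q)); intros H1.
    assert (H2 : exp q * exp (- q) = 1) by (rewrite <- exp_plus; replace (q + - q) with 0 by ring; apply exp_0).
    generalize (exp_pos q). nra. }
  assert ((exp q - 1) * (/ (x + 1) - g x) <= (q + 2 * q * q) * (/ (x + 1) - g x))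
    by (apply Rmult_le_compat_r; lra).
  lra.
Qed.

Lemma scaling_0_le (g : R -> R) : is_scaling g -> g 0 <= 2 / 3.
Proof.
  intros Hg. destruct (Hg 0 ltac:(lra)) as (I0 & HI & ->).
  replace (0 + 1) with 1 in * by ring.
  (* The rational factor is a convergent, from above, of the continued fraction of [exp y * E_1 y].
     The derivative of [F] exceeds the integrand by [2 * exp (- y) / (y * (y + 2))^2], and the
     factor equals 2/3 at 1. *)
  set (F := fun y => - exp (- y) * ((y + 1) / (y * (y + 2)))).
  assert (I0 <= - F 1).
  { apply (improper_le 1 I0 _ ltac:(lra) HI). intros b Hb.
    apply Rle_trans with (F b - F 1).
    - apply RInt_le_of_derive with
        (dF := fun y => exp (- y) * ((y * y * y + 4 * y * y + 4 * y + 2) / ((y * (y + 2)) * (y * (y + 2))))); auto.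
      + apply ex_RInt_ef; lra.
      + intros y Hy. unfold F. auto_derive; [nra|]. field. lra.
      + intros y Hy. apply (ex_derive_continuous (K := R_AbsRing) (V := R_NormedModule)).
        auto_derive. nra.
      + intros y Hy. unfold Rdiv at 1. apply Rmult_le_compat_l; [left; apply exp_pos|].
        apply Rminus_le_0.
        replace ((y * y * y + 4 * y * y + 4 * y + 2) / (y * (y + 2) * (y * (y + 2))) - / y)
          with (2 / (y * (y + 2) * (y * (y + 2)))) by (field; lra).
        apply Rdiv_le_0_compat; [lra|]. nra.
    - assert (F b <= 0).
      { unfold F. assert (0 <= (b + 1) / (b * (b + 2))) by (apply Rdiv_le_0_compat; nra).
        generalize (exp_pos (- b)). nra. }
      lra. }
  apply Rle_trans with (exp 1 * - F 1).
  - apply Rmult_le_compat_l; [left; apply exp_pos|auto].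
  - unfold F. rewrite exp_Ropp. right. field. generalize (exp_pos 1); lra.
Qed.

(* The [6/7] Laguerre-Pade approximant of [exp y * E_1 y]: the identity
   [Q^2 - y (P Q - P' Q + P Q') = (7!)^2] makes it a lower bound. *)
Lemma scaling_0_gt (g : R -> R) : is_scaling g -> 596 / 1000 < g 0.
Proof.
  intros Hg. destruct (Hg 0 ltac:(lra)) as (I0 & HI & ->).
  replace (0 + 1) with 1 in * by ring.
  set (P := fun y => 13068 + y * (33984 + y * (23544 + y * (6560 + y * (835 + y * (48 + y)))))).
  set (Q := fun y => 5040 + y * (35280 + y * (52920 + y * (29400 + y * (7350 + y * (882 + y * (49 + y))))))).
  set (N := fun y => Q y * Q y - 25401600).
  set (F := fun y => - exp (- y) * (P y / Q y)).
  assert (Hmul : forall y c e, 1 <= y -> 0 <= c -> 0 <= e -> 0 <= c + y * e) by (intros; nra).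
  assert (HQ : forall y, 1 <= y -> 0 < Q y).
  { intros y Hy. unfold Q. assert (0 <= y * (35280 + y * (52920 + y * (29400 + y * (7350 + y * (882 + y * (49 + y))))))); [|lra].
    apply Rmult_le_pos; [lra|]. repeat (apply Hmul; [lra|lra|]). lra. }
  (* This 3 is the constant in the slack of [improper_ge]. *)
  assert (HPQ : forall y, 1 <= y -> P y / Q y <= 3).
  { intros y Hy. apply Rle_div_l; [apply HQ, Hy|]. apply Rminus_le_0.
    replace (3 * Q y - P y) with
      (2052 + y * (71856 + y * (135216 + y * (81640 + y * (21215 + y * (2598 + y * (146 + y * 3)))))))
      by (unfold P, Q; ring).
    repeat (apply Hmul; [lra|lra|]). lra. }
  assert (- F 1 <= I0).
  { apply (improper_ge 1 I0 _ ltac:(lra) HI). intros b Hb.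
    apply Rle_trans with (F b - F 1).
    - assert (exp (- b) * (P b / Q b) <= exp (- b) * 3)
        by (apply Rmult_le_compat_l; [left; apply exp_pos|apply HPQ, Hb]).
      unfold F at 2. lra.
    - apply RInt_ge_of_derive with
        (dF := fun y => exp (- y) * (N y / (y * (Q y * Q y)))); auto.
      + apply ex_RInt_ef; lra.
      + intros y Hy. generalize (HQ y ltac:(lra)); intros HQy.
        unfold F, N, P, Q in *. auto_derive; [lra|]. field. lra.
      + intros y Hy. generalize (HQ y ltac:(lra)); intros HQy.
        apply (ex_derive_continuous (K := R_AbsRing) (V := R_NormedModule)).
        unfold N, Q in *. auto_derive.
        apply Rmult_integral_contrapositive; split; [lra|].
        apply Rmult_integral_contrapositive; split; lra.
      + intros y Hy. generalize (HQ y ltac:(lra)); intros HQy.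
        unfold Rdiv at 2. apply Rmult_le_compat_l; [left; apply exp_pos|].
        apply Rminus_le_0.
        replace (/ y - N y / (y * (Q y * Q y))) with (25401600 / (y * (Q y * Q y)))
          by (unfold N; field; lra).
        apply Rdiv_le_0_compat; [lra|].
        repeat apply Rmult_lt_0_compat; lra. }
  apply Rlt_le_trans with (exp 1 * - F 1).
  (* Here [P 1 / Q 1] is 78040/130922, about 0.59608. *)
  - unfold F, P, Q. rewrite exp_Ropp. apply Rminus_lt_0.
    generalize (exp_pos 1); intros He.
    field_simplify; lra.
  - apply Rmult_le_compat_l; [left; apply exp_pos|auto].
Qed.

(** * One-step inequalities *)

Lemma ln_le_sub1 (x : R) : 0 < x -> ln x <= x - 1.
Proof.
  intros Hx. generalize (exp_ineq1_le (ln x)). rewrite exp_ln by auto. lra.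
Qed.

Lemma neg_ln_1m_bounds (q : R) : 0 <= q <= 1 / 4 ->
  q <= - ln (1 - q) <= q * (1 + 2 * q).
Proof.
  intros Hq. split.
  - generalize (ln_le_sub1 (1 - q) ltac:(lra)). lra.
  - rewrite <- ln_Rinv by lra.
    eapply Rle_trans; [apply ln_le_sub1, Rinv_0_lt_compat; lra|].
    apply Rmult_le_reg_r with (1 - q); [lra|].
    rewrite Rmult_minus_distr_r, Rinv_l by lra. nra.
Qed.

(** Quantifies [c = exp (- l)] up to the error of positive probabilities: an offer adds [q] to the
    load [l] and [- ln (1 - q)] to [- ln c]. *)
Definition log_close (pm l c : R) : Prop :=
  0 <= l /\ 0 < c <= 1 /\ l <= - ln c <= l * (1 + 2 * pm).

Lemma log_close_step (pm l c q : R) : log_close pm l c -> 0 <= q <= pm -> pm <= 1 / 4 ->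
  log_close pm (l + q) (c * (1 - q)).
Proof.
  intros (Hl & Hc & Hx) Hq Hpm. generalize (neg_ln_1m_bounds q ltac:(lra)); intros Hq'.
  repeat split; try nra; rewrite ln_mult by lra; nra.
Qed.

(** The factor [c * (1 - ln c)] is the integral of [min (c / s) 1] over [0, 1]; for [c = exp (- l)]
    the potential is the term [exp (- l) * g l * (l + 1)] of the limit identity. *)
Definition potential (g : R -> R) (l c : R) : R := g l * (c * (1 - ln c)).

(* The first-order term vanishes because [g' = g - 1/(x+1)]; the rest is [O(pm * q)]. *)
Lemma potential_step (g : R -> R) (pm l c q : R) :
  is_scaling g -> log_close pm l c -> 0 <= q <= pm -> pm <= 1 / 4 ->
  potential g l c - 7 * pm * (c * q)
    <= q * (1 - g l) * c + potential g (l + q) (c * (1 - q)).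
Proof.
  intros Hg (Hl & Hc & Hx) Hq Hpm.
  generalize (scaling_nonneg g l Hg Hl) (scaling_le_inv g l Hg Hl)
    (scaling_step g l q Hg Hl ltac:(lra)) (scaling_nonneg g (l + q) Hg ltac:(lra)).
  generalize (neg_ln_1m_bounds q ltac:(lra)); intros Hln.
  unfold potential. rewrite ln_mult by lra.
  set (x := - ln c) in *. set (y := - ln (1 - q)) in *.
  replace (ln c) with (- x) by (unfold x; ring).
  replace (ln (1 - q)) with (- y) by (unfold y; ring).
  set (u := g l). set (v := g (l + q)). intros Hu Huinv Hv Hv0.
  (* By the differential equation, [h] is minus the slope of [g] at [l]. *)
  set (h := / (l + 1) - u) in *.
  assert (Hinv : / (l + 1) * (l + 1) = 1) by (apply Rinv_l; lra).
  set (w := / (l + 1)) in *.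
  assert (Hw1 : 0 < w <= 1).
  { split; [unfold w; apply Rinv_0_lt_compat; lra|].
    unfold w. rewrite <- Rinv_1. apply Rinv_le_contravar; lra. }
  assert (Hwx : w * (1 + x) <= 1 + 2 * pm).
  { assert (w * (1 + x) <= w * ((l + 1) * (1 + 2 * pm)))
      by (apply Rmult_le_compat_l; nra).
    rewrite <- Rmult_assoc, Hinv in H. lra. }
  assert (Hh0 : 0 <= h) by (unfold h; lra).
  assert (Hhx : h * (1 + x) <= 1 + 2 * pm).
  { apply Rle_trans with (w * (1 + x)); auto.
    apply Rmult_le_compat_r; unfold h; lra. }
  set (Y := (1 - q) * (1 + x + q)).
  assert (HY : 0 <= Y <= 1 + x) by (unfold Y; split; [apply Rmult_le_pos|]; nra).
  assert (H1 : v * Y <= v * ((1 - q) * (1 + x + y))).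
  { apply Rmult_le_compat_l; auto. unfold Y. apply Rmult_le_compat_l; lra. }
  assert (H2 : (u - (q + 2 * q * q) * h) * Y <= v * Y)
    by (apply Rmult_le_compat_r; tauto).
  assert (H3 : (q + 2 * q * q) * h * Y <= (q + 2 * q * q) * (h * (1 + x))).
  { rewrite Rmult_assoc. apply Rmult_le_compat_l; [nra|].
    apply Rmult_le_compat_l; tauto. }
  assert (H4 : 2 * q * q * (h * (1 + x)) <= 2 * q * q * 2)
    by (apply Rmult_le_compat_l; nra).
  assert (H5 : u * (1 + x) + h * (1 + x) <= 1 + 2 * pm).
  { replace (u * (1 + x) + h * (1 + x)) with (w * (1 + x)) by (unfold h; ring). auto. }
  assert (H6 : q * (u * (1 + x) + h * (1 + x)) <= q * (1 + 2 * pm))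
    by (apply Rmult_le_compat_l; lra).
  assert (H7 : u * (q * q) <= 1 * (q * q)) by (apply Rmult_le_compat_r; [nra|lra]).
  assert (H8 : q * q <= pm * q) by (apply Rmult_le_compat_r; lra).
  (* The 7 is 2 + 1 + 4, from [H6], [H7] and [H4], each [q * q] being at most [pm * q]. *)
  assert (Hkey : u * (1 + x) - 7 * pm * q <= q * (1 - u) + v * ((1 - q) * (1 + x + y))).
  { unfold Y in *. lra. }
  generalize (Rmult_le_compat_l c _ _ ltac:(lra) Hkey). lra.
Qed.

(* Expected load of an optimal resource on the event that the algorithm's copy survives:
   [overlap V w] is the integral of [min (V / s) 1] over [w, 1]. *)
Definition overlap (V w : R) : R :=
  if Rle_dec V w then - V * ln w else V * (1 - ln V) - w.

Lemma ln_ratio_le (V w : R) : 0 < V -> 0 < w -> V * (ln w - ln V) <= w - V.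
Proof.
  intros HV Hw. replace (ln w - ln V) with (ln (w / V)).
  2: { unfold Rdiv. rewrite ln_mult, ln_Rinv by auto using Rinv_0_lt_compat. ring. }
  apply Rle_trans with (V * (w / V - 1)).
  - apply Rmult_le_compat_l; [lra|]. apply ln_le_sub1. apply Rdiv_lt_0_compat; auto.
  - right. field. lra.
Qed.

(** The integral over all of [0, 1] is [V * (1 - ln V)], and the integrand [min (V / s) 1]
    contributes at most [w] on [0, w]. *)
Lemma overlap_ge (V w : R) : 0 < V -> 0 < w -> V * (1 - ln V) - w <= overlap V w.
Proof.
  intros HV Hw. unfold overlap. destruct (Rle_dec V w); [|lra].
  generalize (ln_ratio_le V w HV Hw). lra.
Qed.

(** The increment is the integral of [min (V / s) 1] over an interval of length [w * q] ending at
    [w]. There the integrand is at most [min (V / w) 1 / (1 - q)], and the factor [1 - pm] absorbs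
    the denominator. *)
Lemma overlap_step (V w q pm : R) : 0 < V -> 0 < w -> 0 <= q <= pm -> pm < 1 ->
  (1 - pm) * (overlap V (w * (1 - q)) - overlap V w) <= q * Rmin w V.
Proof.
  intros HV Hw Hq Hpm.
  assert (Hw' : 0 < w * (1 - q)) by (apply Rmult_lt_0_compat; lra).
  assert (Hlnq : - ln (1 - q) * (1 - q) <= q).
  { rewrite <- ln_Rinv by lra.
    apply Rle_trans with ((/ (1 - q) - 1) * (1 - q)).
    - apply Rmult_le_compat_r; [lra|]. apply ln_le_sub1, Rinv_0_lt_compat; lra.
    - right. field. lra. }
  assert (Hlnq0 : 0 <= - ln (1 - q)) by (generalize (ln_le_sub1 (1 - q) ltac:(lra)); lra).
  unfold overlap. destruct (Rle_dec V (w * (1 - q))) as [H1|H1];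
    destruct (Rle_dec V w) as [H2|H2].
  - rewrite Rmin_right by lra. rewrite ln_mult by lra.
    apply Rle_trans with (V * (- ln (1 - q) * (1 - q))); [|nra].
    replace (- V * (ln w + ln (1 - q)) - - V * ln w) with (V * - ln (1 - q)) by ring.
    apply Rle_trans with ((1 - q) * (V * - ln (1 - q))); [|lra].
    apply Rmult_le_compat_r; [apply Rmult_le_pos; lra|lra].
  - nra.
  - rewrite Rmin_right by lra. generalize (ln_ratio_le V w HV Hw); intros Hr.
    apply Rle_trans with ((1 - pm) * (w * q)).
    + apply Rmult_le_compat_l; lra.
    + apply Rle_trans with ((1 - q) * (w * q)); [apply Rmult_le_compat_r; nra|nra].
  - rewrite Rmin_left by lra. assert (0 <= w * q) by nra. nra.
Qed.

(** Unless [A] alone suffices, [(1 - a) * (1 - V) <= A < a * (1 - W)] and [a <= 2 / 3] give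
    [1 - V <= 2 * (1 - W)], so the error [7 * pm * (1 - V)] is at most [14 * pm * (1 - W)]. Relative
    to [a >= 1 / 2] this is 28, and the factor [1 - pm] on [S] adds 1, hence 29. *)
Lemma competitive_combine (a gL V W A S pm : R) :
  1 / 2 <= a <= 2 / 3 -> 0 <= gL <= a -> 0 < V <= 1 -> 0 <= W <= 1 -> 0 <= pm <= 1 / 4 ->
  a - 7 * pm * (1 - V) <= A + gL * (V * (1 - ln V)) ->
  (1 - a) * (1 - V) <= A ->
  0 <= S -> (1 - pm) * (V * (1 - ln V) - W) <= S ->
  (1 - 29 * pm) * a * (1 - W) <= A + gL * S.
Proof.
  intros Ha HgL HV HW Hpm H1 H2 HS0 HS.
  set (Z := V * (1 - ln V)) in *.
  assert (HA : 0 <= A) by (eapply Rle_trans; [|exact H2]; apply Rmult_le_pos; lra).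
  assert (HgS : 0 <= gL * S) by (apply Rmult_le_pos; lra).
  destruct (Rle_dec (a * (1 - W)) A) as [Hc|Hc].
  - apply Rle_trans with (1 * (a * (1 - W))); [|lra].
    rewrite Rmult_assoc. apply Rmult_le_compat_r; [apply Rmult_le_pos; lra|lra].
  - assert (HVW : 1 - V <= 2 * (1 - W)) by nra.
    assert (H3 : gL * ((1 - pm) * (Z - W)) <= gL * S) by (apply Rmult_le_compat_l; lra).
    assert (H4 : (1 - pm) * (a - 7 * pm * (1 - V)) <= (1 - pm) * (A + gL * Z))
      by (apply Rmult_le_compat_l; lra).
    assert (H5 : gL * W <= a * W) by (apply Rmult_le_compat_r; lra).
    assert (H6 : (1 - pm) * (gL * W) <= (1 - pm) * (a * W)) by (apply Rmult_le_compat_l; lra).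
    assert (H7 : pm * (1 - V) <= pm * (2 * (1 - W))) by (apply Rmult_le_compat_l; lra).
    assert (H8 : (1 - pm) * (a * (1 - W) - 14 * (pm * (1 - W))) <=
                 (1 - pm) * (a * (1 - W) - 7 * (pm * (1 - V)))).
    { apply Rmult_le_compat_l; lra. }
    assert (H9 : 0 <= pm * A) by (apply Rmult_le_pos; lra).
    assert (H10 : 0 <= pm * (1 - W)) by (apply Rmult_le_pos; lra).
    assert (H11 : 0 <= pm * (pm * (1 - W))) by (apply Rmult_le_pos; lra).
    assert (H12 : 1 / 2 * (pm * (1 - W)) <= a * (pm * (1 - W))) by (apply Rmult_le_compat_r; lra).
    lra.
Qed.

(** * Finite seed distributions *)

Definition lsum (l : list nat) (f : nat -> R) : R :=
  fold_right (fun j a => f j + a) 0 l.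

Lemma lsum_plus l (f h : nat -> R) : lsum l (fun i => f i + h i) = lsum l f + lsum l h.
Proof. induction l as [|j l IH]; simpl; [|rewrite IH]; ring. Qed.

Lemma lsum_scal l c (f : nat -> R) : lsum l (fun i => c * f i) = c * lsum l f.
Proof. induction l as [|j l IH]; simpl; [|rewrite IH]; ring. Qed.

Lemma lsum_le l (f h : nat -> R) : (forall i, In i l -> f i <= h i) -> lsum l f <= lsum l h.
Proof.
  induction l as [|j l IH]; simpl; intros H; [lra|].
  generalize (H j (or_introl eq_refl)) (IH (fun i Hi => H i (or_intror Hi))). lra.
Qed.

Lemma lsum_ext l (f h : nat -> R) : (forall i, In i l -> f i = h i) -> lsum l f = lsum l h.
Proof.
  induction l as [|j l IH]; simpl; intros H; [reflexivity|].
  rewrite H, IH; auto.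
Qed.

Lemma lsum_indic l k (f : nat -> R) : NoDup l -> In k l ->
  lsum l (fun i => if Nat.eqb k i then f i else 0) = f k.
Proof.
  assert (H0 : forall l, ~ In k l -> lsum l (fun i => if Nat.eqb k i then f i else 0) = 0).
  { induction l0 as [|j l0 IH]; simpl; intros H; [reflexivity|].
    destruct (Nat.eqb_spec k j); [exfalso; auto|]. rewrite IH; [ring|tauto]. }
  induction 1 as [|j l Hj Hl IH]; simpl; intros Hk; [tauto|].
  destruct (Nat.eqb_spec k j) as [<-|Hne].
  - rewrite H0 by auto. ring.
  - rewrite IH; [ring|]. destruct Hk; [congruence|auto].
Qed.

Definition below (s c : R) : R := if Rle_dec s c then 1 else 0.

Lemma below_bounds s c : 0 <= below s c <= 1.
Proof. unfold below; destruct (Rle_dec s c); lra. Qed.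

Lemma below_Rmin s c d : below s c * below s d = below s (Rmin c d).
Proof.
  unfold below, Rmin. destruct (Rle_dec c d), (Rle_dec s c), (Rle_dec s d); lra.
Qed.

(* A finitely supported measure on the reals, as a list of (weight, atom). *)
Definition mean (M : list (R * R)) (F : R -> R) : R :=
  fold_right (fun wa acc => fst wa * F (snd wa) + acc) 0 M.

Definition seed_measure (M : list (R * R)) : Prop :=
  Forall (fun wa => 0 <= fst wa /\ snd wa <= 1) M /\ mean M (fun _ => 1) = 1.

Lemma mean_plus (M : list (R * R)) (F G : R -> R) : mean M (fun s => F s + G s) = mean M F + mean M G.
Proof. induction M as [|wa M IH]; simpl; [|rewrite IH]; ring. Qed.

Lemma mean_scal (M : list (R * R)) (c : R) (F : R -> R) : mean M (fun s => c * F s) = c * mean M F.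
Proof. induction M as [|wa M IH]; simpl; [|rewrite IH]; ring. Qed.

Lemma mean_le (M : list (R * R)) (F G : R -> R) : seed_measure M -> (forall s, s <= 1 -> F s <= G s) -> mean M F <= mean M G.
Proof.
  intros [HM _] H. induction HM as [|wa M [Hw Ha] HM IH]; simpl; [lra|].
  generalize (Rmult_le_compat_l _ _ _ Hw (H (snd wa) Ha)). lra.
Qed.

Lemma mean_ext (M : list (R * R)) (F G : R -> R) : seed_measure M -> (forall s, s <= 1 -> F s = G s) -> mean M F = mean M G.
Proof.
  intros HM H. apply Rle_antisym; apply mean_le; auto; intros s Hs; rewrite H by auto; lra.
Qed.

Lemma mean_const M c : seed_measure M -> mean M (fun _ => c) = c.
Proof.
  intros [_ H]. transitivity (c * mean M (fun _ => 1)); [|rewrite H; ring]. rewrite <- mean_scal.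
  f_equal. extensionality s. ring.
Qed.

Definition refine (c : R) (L : list (R * R)) : list (R * R) :=
  flat_map (fun ab => if Rlt_dec (fst ab) c then
                        if Rlt_dec c (snd ab) then (fst ab, c) :: (c, snd ab) :: nil
                        else ab :: nil
                      else ab :: nil) L.

Definition increments (G : R -> R) (L : list (R * R)) : R :=
  fold_right (fun ab acc => G (snd ab) - G (fst ab) + acc) 0 L.

Lemma increments_refine (G : R -> R) c L : increments G (refine c L) = increments G L.
Proof.
  induction L as [|[a b] L IH]; simpl; [reflexivity|].
  destruct (Rlt_dec a c); [destruct (Rlt_dec c b)|]; simpl; rewrite <- IH;
    unfold increments, refine; simpl; ring.
Qed.

Lemma refine_ordered c L : Forall (fun ab => fst ab <= snd ab /\ snd ab <= 1) L ->
  Forall (fun ab => fst ab <= snd ab /\ snd ab <= 1) (refine c L).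
Proof.
  induction 1 as [|[a b] L H HL IH]; simpl in *; [constructor|].
  destruct (Rlt_dec a c); [destruct (Rlt_dec c b)|]; simpl;
    repeat apply Forall_cons; simpl; auto; lra.
Qed.

Definition avoids (c : R) (L : list (R * R)) : Prop :=
  Forall (fun ab => snd ab <= c \/ c <= fst ab) L.

Lemma refine_avoids c L : avoids c (refine c L).
Proof.
  induction L as [|[a b] L IH]; simpl in *; [constructor|].
  unfold avoids in *.
  destruct (Rlt_dec a c); [destruct (Rlt_dec c b)|]; simpl;
    repeat apply Forall_cons; simpl; auto; lra.
Qed.

Lemma avoids_refine c d L : avoids c L -> avoids c (refine d L).
Proof.
  unfold avoids. induction 1 as [|[a b] L H HL IH]; simpl in *; [constructor|].
  destruct (Rlt_dec a d); [destruct (Rlt_dec d b)|]; simpl;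
    repeat apply Forall_cons; simpl; auto; lra.
Qed.

(* The Lebesgue measure on (0, 1], discretised so that it is exact on the cut points. *)
Lemma exact_seed_measure (cl : list R) : exists M, seed_measure M /\
  forall c, In c cl -> 0 <= c <= 1 -> mean M (fun s => below s c) = c.
Proof.
  set (L := fold_right refine ((0, 1) :: nil) cl).
  assert (Hinc : forall G, increments G L = G 1 - G 0).
  { intros G. unfold L. induction cl as [|c cl IH]; simpl; [ring|].
    rewrite increments_refine. apply IH. }
  assert (Hord : Forall (fun ab => fst ab <= snd ab /\ snd ab <= 1) L).
  { unfold L. clear. induction cl as [|c cl IH]; simpl.
    - apply Forall_cons; [simpl; lra|constructor].
    - apply refine_ordered, IH. }
  assert (Hav : forall c, In c cl -> avoids c L).
  { unfold L. clear. induction cl as [|d cl IH]; simpl; [tauto|].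
    intros c [->|Hc]; [apply refine_avoids|apply avoids_refine, IH, Hc]. }
  (* Each cell becomes an atom at its right end. No cell straddles a cut point [c], so the test
     [below] at the atom decides the whole cell. *)
  exists (map (fun ab => (snd ab - fst ab, snd ab)) L). split; [split|].
  - apply Forall_map. eapply Forall_impl; [|exact Hord]. simpl. intros; lra.
  - transitivity (increments (fun x => x) L); [|rewrite Hinc; ring]. clear.
    induction L as [|ab L IH]; simpl; [reflexivity|]. rewrite IH. ring.
  - intros c Hc Hc1.
    (* [Rmin x c] grows by the full length on cells left of [c] and by 0 on the others, and its
       increments telescope. *)
    transitivity (increments (fun x => Rmin x c) L).
    + specialize (Hav c Hc). clear Hinc. clearbody L.
      induction Hord as [|[a b] L Hab HL IH]; simpl in *; [reflexivity|].
      inversion Hav as [|x l Hx Hl]; subst. simpl in Hx. rewrite IH by auto.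
      f_equal. unfold below, Rmin.
      destruct (Rle_dec b c), (Rle_dec a c); lra.
    + rewrite Hinc, Rmin_right, Rmin_left by lra. ring.
Qed.

(* Expectation when the seeds listed in [js] are independent with law [M]. *)
Fixpoint Ex (M : list (R * R)) (js : list nat) (F : (nat -> R) -> R) (u : nat -> R) : R :=
  match js with
  | nil => F u
  | j :: js' => mean M (fun s => Ex M js' F (updr u j s))
  end.

Lemma Ex_plus M js (F G : (nat -> R) -> R) u : Ex M js (fun v => F v + G v) u = Ex M js F u + Ex M js G u.
Proof.
  revert u. induction js as [|j js IH]; simpl; intros u; [reflexivity|].
  rewrite <- mean_plus. f_equal. extensionality s. apply IH.
Qed.

Lemma Ex_scal M js c (F : (nat -> R) -> R) u : Ex M js (fun v => c * F v) u = c * Ex M js F u.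
Proof.
  revert u. induction js as [|j js IH]; simpl; intros u; [reflexivity|].
  rewrite <- mean_scal. f_equal. extensionality s. apply IH.
Qed.

Lemma Ex_le M js (F G : (nat -> R) -> R) u : seed_measure M ->
  (forall v, F v <= G v) -> Ex M js F u <= Ex M js G u.
Proof.
  intros HM H. revert u. induction js as [|j js IH]; simpl; intros u; [apply H|].
  apply mean_le; auto.
Qed.

Lemma Ex_0 M js u : Ex M js (fun _ => 0) u = 0.
Proof.
  transitivity (0 * Ex M js (fun _ => 0) u); [|ring].
  rewrite <- Ex_scal. f_equal. extensionality v. ring.
Qed.

Lemma Ex_lsum M js l (F : nat -> (nat -> R) -> R) u :
  Ex M js (fun v => lsum l (fun i => F i v)) u = lsum l (fun i => Ex M js (F i) u).
Proof.
  induction l as [|i l IH]; simpl; [apply Ex_0|].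
  rewrite <- IH, <- Ex_plus. reflexivity.
Qed.

Lemma Ex_mean M js (K : R -> (nat -> R) -> R) u :
  Ex M js (fun v => mean M (fun s => K s v)) u = mean M (fun s => Ex M js (K s) u).
Proof.
  (* Only the two [mean] copies of [M] are generalised, so that the induction leaves the measure
     inside [Ex] fixed. *)
  set (N := M) at 2 3. clearbody N.
  induction N as [|wa N IH]; simpl; [apply Ex_0|].
  rewrite <- IH, <- Ex_scal, <- Ex_plus. reflexivity.
Qed.

Lemma updr_same u i s : updr u i s i = s.
Proof. unfold updr. now rewrite Nat.eqb_refl. Qed.

Lemma updr_diff u i j s : j <> i -> updr u i s j = u j.
Proof. unfold updr. destruct (Nat.eqb_spec j i); congruence. Qed.

Lemma updr_updr u i s s' : updr (updr u i s) i s' = updr u i s'.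
Proof. extensionality j. unfold updr. destruct (Nat.eqb j i); reflexivity. Qed.

Lemma updr_comm u i j s s' : i <> j -> updr (updr u i s) j s' = updr (updr u j s') i s.
Proof.
  intros H. extensionality k. unfold updr.
  destruct (Nat.eqb_spec k j), (Nat.eqb_spec k i); congruence.
Qed.

Lemma Ex_updr_notin M js i s (F : (nat -> R) -> R) u : ~ In i js ->
  Ex M js (fun v => F (updr v i s)) u = Ex M js F (updr u i s).
Proof.
  revert u. induction js as [|j js IH]; simpl; intros u H; [reflexivity|].
  f_equal. extensionality s'. rewrite IH by tauto. f_equal. apply updr_comm. tauto.
Qed.

(** Fubini for finite measures; it allows a bound proved for one random seed, with the other seeds
    fixed, to be averaged. *)
Lemma Ex_resample M js i (F : (nat -> R) -> R) u : seed_measure M -> NoDup js -> In i js ->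
  Ex M js F u = Ex M js (fun v => mean M (fun s => F (updr v i s))) u.
Proof.
  intros HM Hnd. revert u. induction Hnd as [|j js Hj Hnd IH]; simpl; intros u Hi; [tauto|].
  destruct (Nat.eq_dec j i) as [->|Hne].
  - rewrite <- (mean_const M (mean M (fun s => Ex M js F (updr u i s))) HM).
    f_equal. extensionality s'. rewrite Ex_mean. f_equal. extensionality s.
    rewrite Ex_updr_notin by auto. now rewrite updr_updr.
  - f_equal. extensionality s. apply IH. destruct Hi; [congruence|auto].
Qed.

Definition lprod (js : list nat) (f : nat -> R) : R :=
  fold_right (fun j a => f j * a) 1 js.

Lemma lprod_ext l (f h : nat -> R) : (forall i, In i l -> f i = h i) -> lprod l f = lprod l h.
Proof.
  induction l as [|j l IH]; simpl; intros H; [reflexivity|].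
  rewrite H, IH; auto.
Qed.

Lemma lprod_1 l : lprod l (fun _ => 1) = 1.
Proof. induction l as [|j l IH]; simpl; [|rewrite IH]; ring. Qed.

Lemma lprod_split l i (f : nat -> R) : NoDup l -> In i l ->
  exists z, forall x, lprod l (updr f i x) = x * z.
Proof.
  induction 1 as [|j l Hj Hl IH]; simpl; intros Hi; [tauto|].
  destruct (Nat.eq_dec j i) as [->|Hne].
  - exists (lprod l f). intros x. rewrite updr_same. f_equal.
    apply lprod_ext. intros k Hk. apply updr_diff. congruence.
  - destruct IH as [z Hz]; [destruct Hi; [congruence|auto]|].
    exists (f j * z). intros x. rewrite Hz, updr_diff by auto. ring.
Qed.

Lemma Ex_mult_notin M js j (h : R -> R) (F : (nat -> R) -> R) u : ~ In j js ->
  Ex M js (fun v => h (v j) * F v) u = h (u j) * Ex M js F u.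
Proof.
  revert u. induction js as [|k js IH]; simpl; intros u H; [reflexivity|].
  rewrite <- mean_scal. f_equal. extensionality s. rewrite IH by tauto.
  rewrite updr_diff by (intros ->; tauto). reflexivity.
Qed.

Lemma Ex_lprod M js (Phi : nat -> R -> R) u : NoDup js ->
  Ex M js (fun v => lprod js (fun j => Phi j (v j))) u = lprod js (fun j => mean M (Phi j)).
Proof.
  intros Hnd. revert u. induction Hnd as [|j js Hj Hnd IH]; simpl; intros u; [reflexivity|].
  transitivity (mean M (fun s => lprod js (fun j0 => mean M (Phi j0)) * Phi j s)).
  - f_equal. extensionality s. rewrite (Ex_mult_notin M js j (Phi j)) by auto.
    rewrite IH, updr_same. ring.
  - rewrite mean_scal. ring.
Qed.

(** * Decision trees driven by seeds *)

Definition small_probs (I : instance) (pm : R) : Prop :=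
  0 <= pm <= 1 / 4 /\
  forall i t, (i < nI I)%nat -> (t < nT I)%nat -> E I i t = true -> 0 <= p I i t <= pm.

(** The survival thresholds that resource [i] can reach. Restricting [f] to processed arrivals
    ensures that a new arrival contributes its factor only once, so each threshold is a subset
    product. *)
Definition cut_point (I : instance) (i : nat) (done : nat -> bool) (c : R) : Prop :=
  0 < c <= 1 /\
  exists f : nat -> bool, (forall t, f t = true -> done t = true) /\
    c = lprod (seq 0 (nT I)) (fun t => if f t then 1 - p I i t else 1).

Lemma updb_diff f k b j : j <> k -> updb f k b j = f j.
Proof. unfold updb. destruct (Nat.eqb_spec j k); congruence. Qed.

Lemma updb_same f k b : updb f k b k = b.
Proof. unfold updb. now rewrite Nat.eqb_refl. Qed.

Lemma updb_true f k j : f j = true -> updb f k true j = true.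
Proof. unfold updb. now destruct (Nat.eqb j k). Qed.

Lemma cut_point_mono I i done t c : cut_point I i done c -> cut_point I i (updb done t true) c.
Proof.
  intros (Hc & f & Hf & ->). split; [exact Hc|]. exists f. split; [|reflexivity].
  intros t' Ht'. apply updb_true; auto.
Qed.

Lemma cut_point_step I i done t c : cut_point I i done c -> done t = false ->
  (t < nT I)%nat -> 0 <= p I i t < 1 -> cut_point I i (updb done t true) (c * (1 - p I i t)).
Proof.
  intros (Hc & f & Hf & Heq) Ht Htn Hp. split; [nra|].
  assert (Hft : f t = false).
  { destruct (f t) eqn:Hft; auto. apply Hf in Hft. congruence. }
  exists (updb f t true). split.
  - intros t'. unfold updb. destruct (Nat.eqb t' t); auto.
  - set (h := fun t' => if f t' then 1 - p I i t' else 1) in *.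
    destruct (lprod_split (seq 0 (nT I)) t h) as [z Hz]; [apply seq_NoDup|apply in_seq; lia|].
    replace h with (updr h t 1) in Heq.
    2: { extensionality t'. unfold updr, h. destruct (Nat.eqb_spec t' t) as [->|]; auto.
         now rewrite Hft. }
    replace (fun t' => if updb f t true t' then 1 - p I i t' else 1) with (updr h t (1 - p I i t)).
    2: { extensionality t'. unfold updr, h, updb. destruct (Nat.eqb_spec t' t) as [->|]; auto. }
    rewrite Hz in *. rewrite Heq. ring.
Qed.

Lemma cut_point_1 I i done : cut_point I i done 1.
Proof.
  split; [lra|]. exists (fun _ => false). split; [discriminate|]. symmetry. apply lprod_1.
Qed.

Fixpoint subset_products (h : nat -> R) (l : list nat) : list R :=
  match l with
  | nil => 1 :: nil
  | t :: l' => subset_products h l' ++ map (Rmult (h t)) (subset_products h l')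
  end.

Lemma In_subset_products h l (f : nat -> bool) :
  In (lprod l (fun t => if f t then h t else 1)) (subset_products h l).
Proof.
  induction l as [|t l IH]; simpl; [auto|]. apply in_or_app. destruct (f t).
  - right. apply in_map, IH.
  - left. rewrite Rmult_1_l. apply IH.
Qed.

(** Runs of valid policies compare seeds only with cut points, and an instance has finitely many of
    them, so a finite measure that is exact there can replace the uniform law. *)
Definition exact_on_cuts (I : instance) (M : list (R * R)) : Prop :=
  seed_measure M /\
  forall i done c, (i < nI I)%nat -> cut_point I i done c -> mean M (fun s => below s c) = c.

Lemma exact_on_cuts_exists (I : instance) : exists M, exact_on_cuts I M.
Proof.
  destruct (exact_seed_measure (flat_map (fun i =>
    subset_products (fun t => 1 - p I i t) (seq 0 (nT I))) (seq 0 (nI I)))) as (M & HM & Hcut).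
  exists M. split; [exact HM|]. intros i done c Hi (Hc & f & _ & Heq). apply Hcut; [|lra].
  apply in_flat_map. exists i. split; [apply in_seq; lia|]. subst c.
  apply In_subset_products with (h := fun t => 1 - p I i t).
Qed.

(* Run of the decision tree [pol] on the seeds [u]: resource [i] is still available as long as
   [u i <= U i], where [U i] is the product of [1 - p] over the offers of [i] made so far, and
   [l i] is the sum of the [p]'s. The weights [phi t i (l i)] of all offers are added up. *)
Fixpoint run (I : instance) (phi : nat -> nat -> R -> R) (pol : policy)
    (U l u : nat -> R) : R :=
  match pol with
  | Stop => 0
  | Skip _ k => run I phi k U l u
  | Offer t i ks kf =>
      phi t i (l i) +
      (if Rle_dec (u i) (U i * (1 - p I i t))
       then run I phi kf (updr U i (U i * (1 - p I i t))) (updr l i (l i + p I i t)) u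
       else run I phi ks U l u)
  end.

Lemma run_plus I (phi psi : nat -> nat -> R -> R) pol U l u :
  run I (fun t j x => phi t j x + psi t j x) pol U l u =
  run I phi pol U l u + run I psi pol U l u.
Proof.
  revert U l. induction pol as [|t k IH|t i ks IHs kf IHf]; simpl; intros U l; auto; [ring|].
  destruct (Rle_dec _ _); rewrite ?IHs, ?IHf; ring.
Qed.

Lemma run_scal I c (phi : nat -> nat -> R -> R) pol U l u :
  run I (fun t j x => c * phi t j x) pol U l u = c * run I phi pol U l u.
Proof.
  revert U l. induction pol as [|t k IH|t i ks IHs kf IHf]; simpl; intros U l; auto; [ring|].
  destruct (Rle_dec _ _); rewrite ?IHs, ?IHf; ring.
Qed.

Lemma run_0 I pol U l u : run I (fun _ _ _ => 0) pol U l u = 0.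
Proof.
  revert U l. induction pol as [|t k IH|t i ks IHs kf IHf]; simpl; intros U l; auto.
  destruct (Rle_dec _ _); rewrite ?IHs, ?IHf; ring.
Qed.

Lemma run_lsum I js (phi : nat -> nat -> nat -> R -> R) pol U l u :
  run I (fun t j x => lsum js (fun i => phi i t j x)) pol U l u =
  lsum js (fun i => run I (phi i) pol U l u).
Proof.
  induction js as [|i js IH]; simpl; [apply run_0|]. rewrite <- IH, <- run_plus. reflexivity.
Qed.

Lemma updr_nonneg (l : nat -> R) i x : (forall j, 0 <= l j) -> 0 <= x ->
  forall j, 0 <= updr l i x j.
Proof. intros Hl Hx j. unfold updr. destruct (Nat.eqb j i); auto. Qed.

Lemma run_le I pm (phi psi : nat -> nat -> R -> R) pol done avail U l u :
  small_probs I pm -> valid I pol done avail -> (forall j, 0 <= l j) ->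
  (forall t j x, (t < nT I)%nat -> (j < nI I)%nat -> E I j t = true -> 0 <= x ->
     phi t j x <= psi t j x) ->
  run I phi pol U l u <= run I psi pol U l u.
Proof.
  intros [Hpm Hp] Hv Hl H. revert done avail U l Hv Hl.
  induction pol as [|t k IH|t i ks IHs kf IHf]; simpl; intros done avail U l Hv Hl.
  - lra.
  - destruct Hv as (_ & _ & Hv). eapply IH; eauto.
  - destruct Hv as (Ht & Hd & Hi & Ha & HE & Hvs & Hvf).
    apply Rplus_le_compat; [auto|].
    destruct (Rle_dec _ _); [eapply IHf|eapply IHs]; eauto.
    apply updr_nonneg; auto. specialize (Hp i t Hi Ht HE). specialize (Hl i). lra.
Qed.

Lemma run_nonneg I pm (phi : nat -> nat -> R -> R) pol done avail U l u :
  small_probs I pm -> valid I pol done avail -> (forall j, 0 <= l j) ->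
  (forall t j x, (t < nT I)%nat -> (j < nI I)%nat -> E I j t = true -> 0 <= x ->
     0 <= phi t j x) ->
  0 <= run I phi pol U l u.
Proof.
  intros Hs Hv Hl H. rewrite <- (run_0 I pol U l u). eapply run_le; eauto.
Qed.

Lemma run_offer_diff I (phi : nat -> nat -> R -> R) t j ks kf U l u i s : j <> i ->
  run I phi (Offer t j ks kf) U l (updr u i s) =
  phi t j (l j) +
  (if Rle_dec (u j) (U j * (1 - p I j t))
   then run I phi kf (updr U j (U j * (1 - p I j t))) (updr l j (l j + p I j t)) (updr u i s)
   else run I phi ks U l (updr u i s)).
Proof. intros H. simpl. now rewrite updr_diff by exact H. Qed.

Lemma run_offer_same I (phi : nat -> nat -> R -> R) t ks kf U l u i s :
  run I phi (Offer t i ks kf) U l (updr u i s) =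
  phi t i (l i) +
  (if Rle_dec s (U i * (1 - p I i t))
   then run I phi kf (updr U i (U i * (1 - p I i t))) (updr l i (l i + p I i t)) (updr u i s)
   else run I phi ks U l (updr u i s)).
Proof. simpl. now rewrite updr_same. Qed.

Definition reward (I : instance) (t j : nat) (x : R) : R := p I j t * r I j.

Definition set_at {A : Type} (f : nat -> A) (k : nat) (x : A) : nat -> A :=
  fun j => if Nat.eqb j k then x else f j.

Lemma lprod_set_at js (Phi : nat -> R -> R) i h v :
  lprod js (fun j => set_at Phi i h j (v j)) = lprod js (updr (fun j => Phi j (v j)) i (h (v i))).
Proof.
  apply lprod_ext. intros j _. unfold set_at, updr. destruct (Nat.eqb_spec j i); congruence.
Qed.

(* [Phi j] is the density describing what the run has revealed about seed [j]. *)
Lemma run_reward_pval_gen I pm M pol done avail U l Phi u :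
  small_probs I pm -> exact_on_cuts I M -> valid I pol done avail ->
  (forall j, (j < nI I)%nat -> cut_point I j done (U j)) ->
  (forall j, (j < nI I)%nat -> avail j = true -> Phi j = fun s => below s (U j)) ->
  Ex M (seq 0 (nI I)) (fun v => lprod (seq 0 (nI I)) (fun j => Phi j (v j)) *
                                run I (reward I) pol U l v) u =
  lprod (seq 0 (nI I)) (fun j => mean M (Phi j)) * pval I pol.
Proof.
  intros [Hpm Hp] [HM Hex]. set (js := seq 0 (nI I)).
  assert (Hnd : NoDup js) by apply seq_NoDup.
  revert done avail U l Phi.
  induction pol as [|t k IH|t i ks IHs kf IHf]; simpl; intros done avail U l Phi Hv HU HPhi.
  - transitivity (Ex M js (fun _ => 0) u); [|rewrite Ex_0; ring].
    f_equal. extensionality v. ring.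
  - destruct Hv as (_ & _ & Hv). eapply IH; eauto. auto using cut_point_mono.
  - destruct Hv as (Ht & Hd & Hi & Ha & HE & Hvs & Hvf).
    specialize (Hp i t Hi Ht HE). set (q := p I i t) in *.
    set (c' := U i * (1 - q)).
    assert (Hc := HU i Hi).
    assert (Hc' : cut_point I i (updb done t true) c') by (apply cut_point_step; auto; fold q; lra).
    assert (Hin : In i js) by (apply in_seq; lia).
    (* A failure reveals that the seed is at most [c'], a success that it lies in [(c', U i]]. The
       indicator of the latter is written with [+ -1 *] to match [mean_plus] and [mean_scal]. *)
    set (Phif := set_at Phi i (fun s => below s c')).
    set (Phis := set_at Phi i (fun s => below s (U i) + -1 * below s c')).
    assert (HUs : forall j, (j < nI I)%nat -> cut_point I j (updb done t true) (U j))
      by auto using cut_point_mono.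
    specialize (IHf (updb done t true) avail (updr U i c') (updr l i (l i + q)) Phif Hvf).
    specialize (IHs (updb done t true) (updb avail i false) U l Phis Hvs HUs).
    transitivity (Ex M js (fun v => q * r I i * lprod js (fun j => Phi j (v j))) u +
       (Ex M js (fun v => lprod js (fun j => Phif j (v j)) *
              run I (reward I) kf (updr U i c') (updr l i (l i + q)) v) u +
        Ex M js (fun v => lprod js (fun j => Phis j (v j)) * run I (reward I) ks U l v) u)).
    + rewrite <- !Ex_plus. f_equal. extensionality v. unfold reward at 1.
      fold q. fold c'. unfold Phif, Phis. rewrite !lprod_set_at.
      destruct (lprod_split js i (fun j => Phi j (v j)) Hnd Hin) as [z Hz].
      replace (lprod js (fun j => Phi j (v j))) with (below (v i) (U i) * z).
      2: { rewrite <- Hz. apply lprod_ext. intros j _. unfold updr.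
           destruct (Nat.eqb_spec j i) as [->|]; auto. now rewrite HPhi by auto. }
      rewrite !Hz. destruct Hc as [Hc _].
      assert (c' <= U i) by (unfold c'; nra).
      unfold below. destruct (Rle_dec (v i) c'), (Rle_dec (v i) (U i)); try lra; ring.
    + assert (HUf : forall j, (j < nI I)%nat -> cut_point I j (updb done t true) (updr U i c' j)).
      { intros j Hj. unfold updr. destruct (Nat.eqb_spec j i) as [->|]; auto. }
      rewrite IHf; [|exact HUf|].
      2: { intros j Hj Haj. unfold Phif, set_at, updr.
           destruct (Nat.eqb_spec j i); auto. }
      rewrite IHs.
      2: { intros j Hj. unfold Phis, set_at, updb.
           destruct (Nat.eqb_spec j i); [discriminate|auto]. }
      rewrite Ex_scal, Ex_lprod by exact Hnd.
      destruct (lprod_split js i (fun j => mean M (Phi j)) Hnd Hin) as [z Hz].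
      assert (Hset : forall h, lprod js (fun j => mean M (set_at Phi i h j)) = mean M h * z).
      { intros h. rewrite <- Hz. apply lprod_ext. intros j _. unfold set_at, updr.
        now destruct (Nat.eqb j i). }
      unfold Phif, Phis. rewrite !Hset.
      replace (lprod js (fun j => mean M (Phi j))) with (U i * z).
      2: { rewrite <- (Hex i done (U i) Hi Hc) at 1. rewrite <- Hz. apply lprod_ext. intros j _.
           unfold updr. destruct (Nat.eqb_spec j i) as [->|]; auto. now rewrite HPhi by auto. }
      rewrite mean_plus, mean_scal, (Hex i _ _ Hi Hc), (Hex i _ _ Hi Hc').
      unfold c'. ring.
Qed.

Lemma Ex_ext_support M js (F G : (nat -> R) -> R) u : seed_measure M -> NoDup js ->
  (forall v, (forall j, In j js -> v j <= 1) -> F v = G v) -> Ex M js F u = Ex M js G u.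
Proof.
  intros HM Hnd H.
  assert (Hgen : forall v, (forall j, In j js -> v j <= 1) ->
            (forall j, ~ In j js -> v j = u j) -> F v = G v) by auto.
  clear H. revert u Hgen. induction Hnd as [|j js Hj Hnd IH]; simpl; intros u H.
  - apply H; tauto.
  - apply mean_ext; auto. intros s Hs. apply IH. intros v Hv1 Hv2. apply H.
    + intros k [<-|Hk]; auto. rewrite Hv2, updr_same; auto.
    + intros k Hk. rewrite Hv2, updr_diff by (try intros ->; tauto). reflexivity.
Qed.

(** Seeds reproduce independent offers, and counting [p * r] at every offer has the same mean as
    collecting [r] at every success. The initial densities are [below s 1], which equal 1 on the
    support. *)
Lemma run_reward_pval I pm M pol u l :
  small_probs I pm -> exact_on_cuts I M -> valid I pol (fun _ => false) (fun _ => true) ->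
  Ex M (seq 0 (nI I)) (fun v => run I (reward I) pol (fun _ => 1) l v) u = pval I pol.
Proof.
  intros Hs HM Hv. assert (HM' := HM). destruct HM' as [HM1 Hex].
  transitivity (lprod (seq 0 (nI I)) (fun _ => mean M (fun s => below s 1)) * pval I pol).
  - rewrite <- (run_reward_pval_gen I pm M pol (fun _ => false) (fun _ => true)
      (fun _ => 1) l (fun _ s => below s 1) u); auto using cut_point_1.
    apply Ex_ext_support; auto using seq_NoDup. intros v Hv1.
    replace (lprod (seq 0 (nI I)) (fun j => below (v j) 1)) with 1; [ring|].
    symmetry. transitivity (lprod (seq 0 (nI I)) (fun _ => 1)); [|apply lprod_1].
    apply lprod_ext. intros j Hj. unfold below. destruct (Rle_dec (v j) 1) as [|Hn]; auto. destruct Hn; auto.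
  - rewrite (lprod_ext _ _ (fun _ => 1)), lprod_1; [ring|].
    intros j Hj. apply (Hex j (fun _ => false)); [apply in_seq in Hj; lia|apply cut_point_1].
Qed.

(** * Charging the algorithm *)

Fixpoint greedy (g : R -> R) (I : instance) (pol : policy) (t : nat)
    (avail : nat -> bool) (l : nat -> R) : Prop :=
  match pol with
  | Stop => (nT I <= t)%nat
  | Skip t' k => t' = t /\ (t < nT I)%nat /\
      (forall i, (i < nI I)%nat -> avail i = true -> E I i t = false) /\
      greedy g I k (S t) avail l
  | Offer t' i ks kf => t' = t /\ (t < nT I)%nat /\
      (i < nI I)%nat /\ avail i = true /\ E I i t = true /\
      (forall j, (j < nI I)%nat -> avail j = true -> E I j t = true ->
         p I j t * r I j * g (l j) <= p I i t * r I i * g (l i)) /\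
      greedy g I ks (S t) (updb avail i false) l /\
      greedy g I kf (S t) avail (updr l i (l i + p I i t))
  end.

(** A derivation of [alg_val] is itself a decision tree whose nodes record the tie-breaking choices,
    so the algorithm can be analysed with [run] and [pval] like any policy. *)
Lemma alg_val_greedy g I t avail l v : alg_val g I t avail l v ->
  exists pol, greedy g I pol t avail l /\ pval I pol = v.
Proof.
  induction 1 as [t avail l Ht|t avail l v Ht HE _ (pol & Hg & Hv)
    |t avail l i vs vf Ht Hi Ha HE Hmax _ (ps & Hgs & Hvs) _ (pf & Hgf & Hvf)].
  - exists Stop. auto.
  - exists (Skip t pol). simpl. auto.
  - exists (Offer t i ps pf). simpl. subst. tauto.
Qed.

Definition future (t : nat) (done : nat -> bool) : Prop :=
  forall t', (t <= t')%nat -> done t' = false.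

Lemma future_step t done : future t done -> future (S t) (updb done t true).
Proof. intros H t' Ht'. rewrite updb_diff by lia. apply H. lia. Qed.

Lemma greedy_valid g I pol t done avail l :
  greedy g I pol t avail l -> future t done -> valid I pol done avail.
Proof.
  revert t done avail l.
  induction pol as [|t' k IH|t' i ks IHs kf IHf]; simpl; intros t done avail l Hg Hd; auto.
  - destruct Hg as (-> & Ht & _ & Hg). split; [|split]; auto.
    eapply IH; eauto using future_step.
  - destruct Hg as (-> & Ht & Hi & Ha & HE & _ & Hgs & Hgf).
    repeat split; eauto using future_step.
Qed.

(* The expected reward [p r] of an offer is split into [p r g(l)], credited to the arrival, and
   [p r (1 - g(l))], credited to the resource; [resource_share] omits the factor [r]. *)
Definition offer_share (g : R -> R) (I : instance) (t' t j : nat) (x : R) : R :=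
  if Nat.eqb t t' then p I j t * r I j * g x else 0.

Definition resource_share (g : R -> R) (I : instance) (i t j : nat) (x : R) : R :=
  if Nat.eqb j i then p I j t * (1 - g x) else 0.

Definition load (I : instance) (i t j : nat) (x : R) : R :=
  if Nat.eqb j i then p I j t else 0.

Lemma scaling_le_1 g x : is_scaling g -> 0 <= x -> g x <= 1.
Proof.
  intros Hg Hx. eapply Rle_trans; [apply scaling_le_inv; auto|].
  rewrite <- Rinv_1. apply Rinv_le_contravar; lra.
Qed.

Lemma scaling_le g x y : is_scaling g -> 0 <= x -> x <= y -> g y <= g x.
Proof.
  intros Hg Hx Hxy. replace y with (x + (y - x)) by ring. apply scaling_anti; auto; lra.
Qed.

(* [V] and [L] are the survival probability and the load that resource [i] reaches when its
   own seed never lets an offer succeed, the other seeds being fixed. *)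
Lemma greedy_resource g I pm M i pol t done avail U l u :
  is_scaling g -> wf_instance I -> small_probs I pm -> exact_on_cuts I M -> (i < nI I)%nat ->
  greedy g I pol t avail l -> future t done -> avail i = true -> (forall j, 0 <= l j) ->
  log_close pm (l i) (U i) -> cut_point I i done (U i) ->
  let A := mean M (fun s => below s (U i) *
                            run I (resource_share g I i) pol U l (updr u i s)) in
  exists V L, 0 < V <= U i /\ l i <= L /\ mean M (fun s => below s V) = V /\
    potential g (l i) (U i) - 7 * pm * (U i - V) <= A + potential g L V /\
    (1 - g 0) * (U i - V) <= A /\
    forall s t', s <= V -> (t <= t' < nT I)%nat -> E I i t' = true ->
      p I i t' * r I i * g L <= run I (offer_share g I t') pol U l (updr u i s).
Proof.
  intros Hg [Hr _] Hs HM Hi. assert (Hs' := Hs). destruct Hs' as [Hpm Hp].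
  assert (HM' := HM). destruct HM' as [HM1 Hex].
  assert (Hpr : forall j t' x, (t' < nT I)%nat -> (j < nI I)%nat -> E I j t' = true -> 0 <= x ->
            0 <= p I j t' * r I j * g x).
  { intros j t' x Ht' Hj HE Hx. apply Rmult_le_pos; [|apply scaling_nonneg; auto].
    apply Rmult_le_pos; [apply Hp; auto|left; auto]. }
  revert t done avail U l.
  induction pol as [|t0 k IH|t0 j ks IHs kf IHf]; intros t done avail U l Hgr Hd Ha Hl Hlog Hcut A.
  - exists (U i), (l i). destruct Hcut as [Hc Hcf]. repeat split; try lra.
    + apply (Hex i done); auto. split; auto.
    + assert (A = 0) as ->; [|lra]. unfold A. simpl.
      rewrite (mean_ext _ _ (fun _ => 0)), mean_const; auto. intros; ring.
    + assert (A = 0) as ->; [|lra]. unfold A. simpl.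
      rewrite (mean_ext _ _ (fun _ => 0)), mean_const; auto. intros; ring.
    + simpl in Hgr. intros s t' _ Ht'. lia.
  (* The algorithm skips [t] only without available neighbours; as [i] is available, [t' = t] cannot
     occur. *)
  - destruct Hgr as (-> & Ht & HnE & Hgr).
    destruct (IH (S t) (updb done t true) avail U l Hgr (future_step t done Hd) Ha Hl Hlog
                (cut_point_mono I i done t _ Hcut)) as (V & L & H1 & H2 & H3 & H4 & H5 & H6).
    exists V, L. repeat (split; [assumption|]). intros s t' Hs' Ht' HE.
    apply H6; auto. destruct (Nat.eq_dec t t') as [<-|Hne]; [|lia].
    rewrite HnE in HE by auto. discriminate.
  - assert (Hval := greedy_valid g I _ _ _ _ _ Hgr Hd).
    destruct Hgr as (-> & Ht & Hj & Haj & HEj & Hmax & Hgs & Hgf).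
    assert (Hq := Hp j t Hj Ht HEj).
    assert (Hl' : forall k, 0 <= updr l j (l j + p I j t) k)
      by (apply updr_nonneg; auto; specialize (Hl j); lra).
    destruct Hval as (_ & Hdt & _ & _ & _ & Hvs & Hvf).
    destruct (Nat.eq_dec j i) as [->|Hne].
    + set (q := p I i t) in *. set (c := U i) in *. set (c' := c * (1 - q)).
      assert (Hc'c : c' <= c) by (unfold c'; destruct Hcut; nra).
      assert (Hcut' : cut_point I i (updb done t true) (updr U i c' i)).
      { rewrite updr_same. apply cut_point_step; auto. fold q. lra. }
      assert (Hlog' : log_close pm (updr l i (l i + q) i) (updr U i c' i)).
      { rewrite !updr_same. apply log_close_step; auto. lra. }
      destruct (IHf (S t) (updb done t true) avail (updr U i c') (updr l i (l i + q)) Hgf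
                  (future_step t done Hd) Ha Hl' Hlog' Hcut')
        as (V & L & H1 & H2 & H3 & H4 & H5 & H6).
      rewrite !updr_same in *.
      set (A' := mean M (fun s => below s c' * run I (resource_share g I i) kf (updr U i c')
                                   (updr l i (l i + q)) (updr u i s))) in *.
      assert (Hgl := scaling_le_1 g (l i) Hg (Hl i)).
      (* The continuation after a success is dropped, using only that its payments are
         nonnegative. *)
      assert (HA : q * (1 - g (l i)) * c + A' <= A).
      { unfold A, A'. rewrite <- (Hex i done c Hi Hcut) at 1. rewrite <- mean_scal, <- mean_plus.
        apply mean_le; auto. intros s _. rewrite run_offer_same. fold q. fold c. fold c'.
        unfold resource_share at 2. rewrite Nat.eqb_refl. fold q.
        assert (Hks : 0 <= run I (resource_share g I i) ks U l (updr u i s)).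
        { eapply run_nonneg; eauto. intros t1 j1 x Ht1 Hj1 HE1 Hx. unfold resource_share.
          destruct (Nat.eqb j1 i); [|lra]. specialize (Hp j1 t1 Hj1 Ht1 HE1).
          generalize (scaling_le_1 g x Hg Hx); intros. apply Rmult_le_pos; lra. }
        unfold below. destruct (Rle_dec s c'), (Rle_dec s c); lra. }
      exists V, L. split; [lra|]. split; [lra|]. split; [assumption|]. split; [|split].
      * generalize (potential_step g pm (l i) c q Hg Hlog Hq ltac:(lra)). fold c'.
        replace (c * q) with (c - c') by (unfold c'; ring). lra.
      * generalize (scaling_le g 0 (l i) Hg ltac:(lra) (Hl i)); intros Hg0.
        replace (c - V) with (q * c + (c' - V)) by (unfold c'; ring).
        assert ((q * c) * (1 - g 0) <= (q * c) * (1 - g (l i))).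
        { apply Rmult_le_compat_l; [|lra]. destruct Hcut. apply Rmult_le_pos; lra. }
        lra.
      * intros s t' Hs' Ht' HE. rewrite run_offer_same. fold q. fold c. fold c'.
        destruct (Rle_dec s c') as [_|Hn]; [|lra].
        unfold offer_share at 1. destruct (Nat.eqb_spec t t') as [<-|Htt'].
        -- assert (0 <= run I (offer_share g I t) kf (updr U i c') (updr l i (l i + q)) (updr u i s)).
           { eapply run_nonneg; eauto. intros t1 j1 x Ht1 Hj1 HE1 Hx. unfold offer_share.
             destruct (Nat.eqb t1 t); [|lra]. auto. }
           assert (g L <= g (l i)) by (apply scaling_le; auto; lra).
           fold q. assert (q * r I i * g L <= q * r I i * g (l i)); [|lra].
           apply Rmult_le_compat_l; auto. apply Rmult_le_pos; [apply Hq|left; auto].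
        -- rewrite Rplus_0_l. apply H6; auto. lia.
    + set (q := p I j t) in *.
      assert (Hij : i <> j) by auto.
      (* The outcome of an offer of [j] depends on [u j] and not on [s]. Hence all values of [s]
         continue in one subtree [k], and both outcomes are treated together. *)
      assert (Hstep : exists k U' l' avail', avail' i = true /\ U' i = U i /\ l' i = l i /\
        (forall j, 0 <= l' j) /\ greedy g I k (S t) avail' l' /\
        valid I k (updb done t true) avail' /\
        (forall phi s, run I phi (Offer t j ks kf) U l (updr u i s) =
           phi t j (l j) + run I phi k U' l' (updr u i s)) /\
        (forall (B := mean M (fun s => below s (U' i) *
                            run I (resource_share g I i) k U' l' (updr u i s))),
          exists V L, 0 < V <= U' i /\ l' i <= L /\ mean M (fun s => below s V) = V /\
          potential g (l' i) (U' i) - 7 * pm * (U' i - V) <= B + potential g L V /\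
          (1 - g 0) * (U' i - V) <= B /\
          forall s t', s <= V -> (S t <= t' < nT I)%nat -> E I i t' = true ->
          p I i t' * r I i * g L <= run I (offer_share g I t') k U' l' (updr u i s))).
      { destruct (Rle_dec (u j) (U j * (1 - p I j t))) as [Hle|Hle].
        - exists kf, (updr U j (U j * (1 - q))), (updr l j (l j + q)), avail.
          assert (HU' := updr_diff U j i (U j * (1 - q)) Hij).
          assert (Hl1 := updr_diff l j i (l j + q) Hij).
          repeat (split; [assumption|]). split.
          + intros phi s. rewrite run_offer_diff by auto.
            destruct (Rle_dec (u j) (U j * (1 - p I j t))); [reflexivity|tauto].
          + apply (IHf (S t) (updb done t true) avail); auto using future_step.
            * rewrite HU', Hl1. assumption.
            * rewrite HU'. auto using cut_point_mono.
        - exists ks, U, l, (updb avail j false).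
          assert (Ha' : updb avail j false i = true) by (rewrite updb_diff; auto).
          repeat (split; [first [assumption|reflexivity]|]). split.
          + intros phi s. rewrite run_offer_diff by auto.
            destruct (Rle_dec (u j) (U j * (1 - p I j t))); [tauto|reflexivity].
          + apply (IHs (S t) (updb done t true) (updb avail j false)); auto using future_step.
            auto using cut_point_mono. }
      destruct Hstep as (k & U' & l' & avail' & Ha' & HU' & Hli' & Hlp' & Hgk & Hvk & Hrun & HIH).
      destruct HIH as (V & L & H1 & H2 & H3 & H4 & H5 & H6).
      rewrite HU', Hli' in *.
      replace (mean M (fun s => below s (U i) * run I (resource_share g I i) k U' l' (updr u i s)))
        with A in *.
      2: { unfold A. f_equal. extensionality s. rewrite Hrun. unfold resource_share at 1.
           destruct (Nat.eqb_spec j i); [contradiction|ring]. }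
      exists V, L. repeat (split; [assumption|]). intros s t' Hs' Ht' HE.
      rewrite Hrun. unfold offer_share at 1. destruct (Nat.eqb_spec t t') as [<-|Htt'].
      * assert (0 <= run I (offer_share g I t) k U' l' (updr u i s)).
        { eapply run_nonneg; eauto. intros t1 j1 x Ht1 Hj1 HE1 Hx. unfold offer_share.
          destruct (Nat.eqb t1 t); [|lra]. auto. }
        assert (g L <= g (l i)) by (apply scaling_le; auto; lra).
        assert (p I i t * r I i * g L <= p I i t * r I i * g (l i)).
        { apply Rmult_le_compat_l; auto. apply Rmult_le_pos; [apply Hp; auto|left; auto]. }
        (* Greediness: [t] receives at least what an offer of [i] would have paid it at the current
           load, which is at most [L]. *)
        specialize (Hmax i Hi Ha HE). fold q. lra.
      * rewrite Rplus_0_l. apply H6; auto. lia.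
Qed.

(** * Charging the offline policy *)

Lemma run_load_unavailable I i pol done avail U l u :
  valid I pol done avail -> avail i = false -> run I (load I i) pol U l u = 0.
Proof.
  revert done avail U l.
  induction pol as [|t k IH|t j ks IHs kf IHf]; simpl; intros done avail U l Hv Ha; auto.
  - destruct Hv as (_ & _ & Hv). eapply IH; eauto.
  - destruct Hv as (_ & _ & _ & Haj & _ & Hvs & Hvf).
    assert (Hne : j <> i) by congruence. unfold load at 1.
    destruct (Nat.eqb_spec j i); [contradiction|].
    destruct (Rle_dec _ _); [erewrite IHf by eauto|erewrite IHs]; eauto; try ring.
    now rewrite updb_diff by auto.
Qed.

(** With the other seeds fixed, [w] is the survival probability of [i] along the path on which no
    offer of [i] succeeds. The load telescopes to [U i - w]. Restricted to seeds at most [V], an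
    offer made at level [c] counts [q * Rmin c V], which [overlap_step] compares with the increment
    of [overlap]. *)
Lemma offline_resource I pm M i V pol done avail U l u :
  small_probs I pm -> exact_on_cuts I M -> (i < nI I)%nat ->
  0 < V -> mean M (fun s => below s V) = V ->
  valid I pol done avail -> avail i = true -> cut_point I i done (U i) ->
  exists w, 0 < w <= U i /\
    mean M (fun s => below s (U i) * run I (load I i) pol U l (updr u i s)) = U i - w /\
    (1 - pm) * (overlap V w - overlap V (U i)) <=
    mean M (fun s => below s V * (below s (U i) * run I (load I i) pol U l (updr u i s))).
Proof.
  intros [Hpm Hp] HM Hi HV HVM. assert (HM' := HM). destruct HM' as [HM1 Hex].
  revert done avail U l.
  induction pol as [|t k IH|t j ks IHs kf IHf]; intros done avail U l Hv Ha Hcut.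
  - exists (U i). destruct Hcut as [Hc _]. split; [lra|].
    simpl. split.
    + rewrite (mean_ext _ _ (fun _ => 0)), mean_const; auto; [ring|]. intros; ring.
    + rewrite (mean_ext _ _ (fun _ => 0)), mean_const; auto; [lra|]. intros; ring.
  - destruct Hv as (_ & _ & Hv). eapply (IH (updb done t true) avail U l); eauto using cut_point_mono.
  - destruct Hv as (Ht & Hdt & Hj & Haj & HEj & Hvs & Hvf).
    assert (Hq := Hp j t Hj Ht HEj).
    destruct (Nat.eq_dec j i) as [->|Hne].
    + set (q := p I i t) in *. set (c := U i) in *. set (c' := c * (1 - q)).
      assert (Hc'c : c' <= c) by (unfold c'; destruct Hcut; nra).
      assert (Hcut' : cut_point I i (updb done t true) (updr U i c' i)).
      { rewrite updr_same. apply cut_point_step; auto. fold q. lra. }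
      destruct (IHf (updb done t true) avail (updr U i c') (updr l i (l i + q)) Hvf Ha Hcut')
        as (w & Hw & H1 & H2).
      rewrite !updr_same in *.
      assert (Hpt : forall s, below s c * run I (load I i) (Offer t i ks kf) U l (updr u i s) =
        q * below s c + below s c' * run I (load I i) kf (updr U i c') (updr l i (l i + q)) (updr u i s)).
      { intros s. rewrite run_offer_same. fold q. fold c. fold c'. unfold load at 1.
        rewrite Nat.eqb_refl. fold q.
        rewrite (run_load_unavailable I i ks _ _ U l (updr u i s) Hvs) by apply updb_same.
        unfold below. destruct (Rle_dec s c'), (Rle_dec s c); lra. }
      exists w. split; [lra|]. split.
      * rewrite (mean_ext _ _ _ HM1 (fun s _ => Hpt s)).
        rewrite mean_plus, mean_scal, H1, (Hex i done c Hi Hcut). unfold c'. ring.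
      * apply Rle_trans with (q * Rmin c V + (1 - pm) * (overlap V w - overlap V c')).
        { destruct Hcut as [Hc _].
          generalize (overlap_step V c q pm HV ltac:(lra) Hq ltac:(lra)). fold c'. lra. }
        assert (Hmin : mean M (fun s => below s (Rmin c V)) = Rmin c V).
        { unfold Rmin. destruct (Rle_dec c V); auto. apply (Hex i done c Hi Hcut). }
        rewrite <- Hmin, <- mean_scal.
        eapply Rle_trans; [apply Rplus_le_compat_l, H2|]. rewrite <- mean_plus.
        right. apply mean_ext; auto. intros s _. rewrite Hpt, <- below_Rmin. ring.
    + set (q := p I j t) in *.
      assert (Hij : i <> j) by auto.
      (* An offer of another resource adds no load to [i] and leads to the same subtree for every
         [s], so the claim is inherited from that subtree. *)
      assert (Hfun : forall k U' l',
        (forall s, run I (load I i) (Offer t j ks kf) U l (updr u i s) =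
                   run I (load I i) k U' l' (updr u i s)) -> U' i = U i ->
        (exists w, 0 < w <= U' i /\
          mean M (fun s => below s (U' i) * run I (load I i) k U' l' (updr u i s)) = U' i - w /\
          (1 - pm) * (overlap V w - overlap V (U' i)) <=
          mean M (fun s => below s V * (below s (U' i) * run I (load I i) k U' l' (updr u i s)))) ->
        exists w, 0 < w <= U i /\
          mean M (fun s => below s (U i) *
            run I (load I i) (Offer t j ks kf) U l (updr u i s)) = U i - w /\
          (1 - pm) * (overlap V w - overlap V (U i)) <=
          mean M (fun s => below s V * (below s (U i) *
            run I (load I i) (Offer t j ks kf) U l (updr u i s)))).
      { intros k U' l' Hrun HU' (w & H1 & H2 & H3). rewrite HU' in *. exists w.
        split; [assumption|]. split.
        - rewrite <- H2. f_equal. extensionality s. now rewrite Hrun.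
        - eapply Rle_trans; [exact H3|]. right. f_equal. extensionality s. now rewrite Hrun. }
      assert (Hload : load I i t j (l j) = 0).
      { unfold load. destruct (Nat.eqb_spec j i); [contradiction|reflexivity]. }
      destruct (Rle_dec (u j) (U j * (1 - p I j t))) as [Hle|Hle].
      * assert (HU' := updr_diff U j i (U j * (1 - q)) Hij).
        apply (Hfun kf (updr U j (U j * (1 - q))) (updr l j (l j + q))); [|exact HU'|].
        -- intros s. rewrite run_offer_diff, Hload by auto.
           destruct (Rle_dec (u j) (U j * (1 - p I j t))); [apply Rplus_0_l|tauto].
        -- apply (IHf (updb done t true) avail); auto. rewrite HU'. auto using cut_point_mono.
      * apply (Hfun ks U l); [|reflexivity|].
        -- intros s. rewrite run_offer_diff, Hload by auto.
           destruct (Rle_dec (u j) (U j * (1 - p I j t))); [tauto|apply Rplus_0_l].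
        -- apply (IHs (updb done t true) (updb avail j false)); auto using cut_point_mono.
           now rewrite updb_diff by auto.
Qed.

(** * Competitive ratio for one resource and for the whole instance *)

Definition arrival_value (g : R -> R) (I : instance) (alg : policy) (u : nat -> R) (t : nat) : R :=
  run I (offer_share g I t) alg (fun _ => 1) (fun _ => 0) u.

Lemma mean_below_1 M (F : R -> R) : seed_measure M -> mean M (fun s => below s 1 * F s) = mean M F.
Proof.
  intros HM. apply mean_ext; auto. intros s Hs. unfold below.
  destruct (Rle_dec s 1); [ring|contradiction].
Qed.

(** The payments to [i], together with those to the arrivals that the offline policy offers [i],
    cover the offline reward from [i]. *)
Lemma resource_competitive g I pm M i alg opt u :
  is_scaling g -> wf_instance I -> small_probs I pm -> exact_on_cuts I M -> (i < nI I)%nat ->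
  greedy g I alg 0 (fun _ => true) (fun _ => 0) ->
  valid I opt (fun _ => false) (fun _ => true) ->
  (1 - 29 * pm) * g 0 * (r I i *
      mean M (fun s => run I (load I i) opt (fun _ => 1) (fun _ => 0) (updr u i s))) <=
  r I i * mean M (fun s => run I (resource_share g I i) alg (fun _ => 1) (fun _ => 0) (updr u i s)) +
  mean M (fun s => run I (fun t j _ => if Nat.eqb j i then arrival_value g I alg (updr u i s) t else 0)
                     opt (fun _ => 1) (fun _ => 0) (updr u i s)).
Proof.
  intros Hg Hwf Hs HM Hi Halg Hopt.
  assert (HM' := HM). destruct HM' as [HM1 Hex].
  assert (Hri : 0 < r I i) by (apply Hwf, Hi).
  assert (Hlog : log_close pm 0 1) by (unfold log_close; rewrite ln_1; lra).
  destruct (greedy_resource g I pm M i alg 0 (fun _ => false) (fun _ => true)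
    (fun _ => 1) (fun _ => 0) u Hg Hwf Hs HM Hi Halg (fun _ _ => eq_refl) eq_refl
    (fun _ => Rle_refl 0) Hlog (cut_point_1 I i _)) as (V & L & HV & HL & HVM & H1 & H2 & H3).
  rewrite mean_below_1 in H1, H2 by auto.
  set (A := mean M _) in H1, H2. fold A.
  destruct (offline_resource I pm M i V opt (fun _ => false) (fun _ => true)
    (fun _ => 1) (fun _ => 0) u Hs HM Hi ltac:(lra) HVM Hopt eq_refl (cut_point_1 I i _))
    as (W & HW & H4 & H5).
  rewrite mean_below_1 in H4 by auto. rewrite H4.
  set (S := mean M _) in H5.
  assert (HSeq : S = mean M (fun s => below s V *
    run I (load I i) opt (fun _ => 1) (fun _ => 0) (updr u i s))).
  { unfold S. apply mean_ext; auto. intros s Hs1. unfold below at 2.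
    destruct (Rle_dec s 1); [ring|contradiction]. }
  assert (HgL : 0 <= g L <= g 0).
  { split; [apply scaling_nonneg|apply scaling_le]; auto; lra. }
  assert (HS0 : 0 <= S).
  { rewrite HSeq. apply Rle_trans with (mean M (fun _ => 0)).
    { rewrite mean_const by auto. lra. }
    apply mean_le; auto. intros s _.
    apply Rmult_le_pos; [apply below_bounds|]. eapply run_nonneg; eauto.
    - simpl; intros; lra.
    - intros t j x Ht Hj HE Hx. unfold load. destruct (Nat.eqb j i); [|lra]. apply Hs; auto. }
  assert (HC : (1 - 29 * pm) * g 0 * (1 - W) <= A + g L * S).
  { apply (competitive_combine (g 0) (g L) V W A S pm); auto; try lra.
    - generalize (scaling_0_gt g Hg) (scaling_0_le g Hg). lra.
    - apply Hs.
    - unfold potential in H1. rewrite ln_1 in H1. lra.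
    - eapply Rle_trans; [|exact H5]. destruct Hs as [Hpm _].
      apply Rmult_le_compat_l; [lra|].
      generalize (overlap_ge V W ltac:(lra) ltac:(lra)).
      replace (overlap V 1) with 0; [lra|].
      unfold overlap. rewrite ln_1. destruct (Rle_dec V 1); lra. }
  apply Rle_trans with (r I i * (A + g L * S)).
  { generalize (Rmult_le_compat_l (r I i) _ _ ltac:(lra) HC). lra. }
  rewrite Rmult_plus_distr_l. apply Rplus_le_compat_l.
  rewrite HSeq, <- !mean_scal. apply mean_le; auto. intros s _.
  (* For seeds at most [V], each arrival that is offered [i] holds at least [p * r * g L]; for
     larger seeds nonnegativity of the payments suffices. *)
  unfold below. destruct (Rle_dec s V) as [HsV|HsV].
  - replace (r I i * (g L * (1 * run I (load I i) opt (fun _ => 1) (fun _ => 0) (updr u i s))))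
      with (r I i * g L * run I (load I i) opt (fun _ => 1) (fun _ => 0) (updr u i s)) by ring.
    rewrite <- run_scal. eapply run_le; eauto; [simpl; intros; lra|].
    intros t j x Ht Hj HE Hx. unfold load. destruct (Nat.eqb_spec j i) as [->|]; [|lra].
    generalize (H3 s t HsV ltac:(lia) HE). unfold arrival_value. lra.
  - rewrite Rmult_0_l, !Rmult_0_r. eapply run_nonneg; eauto; [simpl; intros; lra|].
    intros t j x Ht Hj HE Hx. destruct (Nat.eqb j i); [|lra].
    unfold arrival_value. eapply run_nonneg; eauto.
    + eapply greedy_valid; eauto. intros ? _. reflexivity.
    + simpl; intros; lra.
    + intros t1 j1 x1 Ht1 Hj1 HE1 Hx1. unfold offer_share. destruct (Nat.eqb t1 t); [|lra].
      apply Rmult_le_pos; [|apply scaling_nonneg; auto].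
      apply Rmult_le_pos; [apply Hs; auto|left; apply Hwf; auto].
Qed.

(** An offline run processes each arrival at most once, so no payment to an arrival is charged
    twice. *)
Lemma run_arrivals_le I (f : nat -> R) pol done avail U l u :
  valid I pol done avail -> (forall t, 0 <= f t) ->
  run I (fun t _ _ => f t) pol U l u <=
  lsum (seq 0 (nT I)) (fun t => if done t then 0 else f t).
Proof.
  intros Hv Hf. revert done avail U l Hv.
  induction pol as [|t k IH|t i ks IHs kf IHf]; simpl; intros done avail U l Hv.
  - apply Rle_trans with (lsum (seq 0 (nT I)) (fun t => 0 * 0)).
    + rewrite lsum_scal. lra.
    + apply lsum_le. intros t _. specialize (Hf t). destruct (done t); lra.
  - destruct Hv as (_ & _ & Hv). eapply Rle_trans; [eapply IH; eauto|].
    apply lsum_le. intros t' _. unfold updb. specialize (Hf t').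
    destruct (Nat.eqb t' t), (done t'); lra.
  - destruct Hv as (Ht & Hd & _ & _ & _ & Hvs & Hvf).
    replace (lsum (seq 0 (nT I)) (fun t' => if done t' then 0 else f t'))
      with (f t + lsum (seq 0 (nT I)) (fun t' => if updb done t true t' then 0 else f t')).
    2: { rewrite <- (lsum_indic (seq 0 (nT I)) t f), <- lsum_plus;
           [|apply seq_NoDup|apply in_seq; lia].
         apply lsum_ext. intros t' _. unfold updb. rewrite (Nat.eqb_sym t' t).
         destruct (Nat.eqb_spec t t') as [<-|]; [rewrite Hd|destruct (done t')]; ring. }
    apply Rplus_le_compat_l. destruct (Rle_dec _ _); eauto.
Qed.

Lemma small_competitive g I pm alg opt :
  is_scaling g -> wf_instance I -> small_probs I pm -> 29 * pm <= 1 ->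
  greedy g I alg 0 (fun _ => true) (fun _ => 0) ->
  valid I opt (fun _ => false) (fun _ => true) ->
  (1 - 29 * pm) * g 0 * pval I opt <= pval I alg.
Proof.
  intros Hg Hwf Hs Hpm29 Halg Hopt.
  destruct (exact_on_cuts_exists I) as [M HM]. assert (HM' := HM). destruct HM' as [HM1 _].
  set (js := seq 0 (nI I)). set (one := fun _ : nat => 1). set (zero := fun _ : nat => 0).
  assert (Hnd : NoDup js) by apply seq_NoDup.
  assert (Hvalg : valid I alg (fun _ => false) (fun _ => true)).
  { eapply greedy_valid; eauto. intros ? _. reflexivity. }
  assert (Hz : forall j, 0 <= zero j) by (intros; unfold zero; lra).
  assert (Hlam : forall v t, 0 <= arrival_value g I alg v t).
  { intros v t. unfold arrival_value. eapply run_nonneg; eauto.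
    intros t1 j1 x1 Ht1 Hj1 HE1 Hx1. unfold offer_share. destruct (Nat.eqb t1 t); [|lra].
    apply Rmult_le_pos; [|apply scaling_nonneg; auto].
    apply Rmult_le_pos; [apply Hs; auto|left; apply Hwf; auto]. }
  rewrite <- (run_reward_pval I pm M alg zero zero Hs HM Hvalg).
  rewrite <- (run_reward_pval I pm M opt zero zero Hs HM Hopt). fold js one.
  set (TH := fun i v => run I (resource_share g I i) alg one zero v).
  set (LA := fun i v => run I (fun t j _ => if Nat.eqb j i then arrival_value g I alg v t else 0)
                          opt one zero v).
  set (LO := fun i v => run I (load I i) opt one zero v).
  assert (Hcoef : 0 <= (1 - 29 * pm) * g 0).
  { apply Rmult_le_pos; [lra|]. apply scaling_nonneg; auto; lra. }
  apply Rle_trans with (Ex M js (fun v => lsum js (fun i => r I i * TH i v + LA i v)) zero).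
  - apply Rle_trans with ((1 - 29 * pm) * g 0 * Ex M js (fun v => lsum js (fun i => r I i * LO i v)) zero).
    + apply Rmult_le_compat_l; auto. apply Ex_le; auto. intros v. unfold LO.
      rewrite (lsum_ext js _ _ (fun i _ => eq_sym (run_scal I (r I i) (load I i) opt one zero v))).
      rewrite <- (run_lsum I js (fun i t j x => r I i * load I i t j x)).
      eapply run_le; eauto. intros t j x Ht Hj HE Hx. right.
      unfold reward. rewrite Rmult_comm.
      rewrite <- (lsum_indic js j (fun i => r I i * p I j t) Hnd) by (apply in_seq; lia).
      apply lsum_ext. intros i _. unfold load. destruct (Nat.eqb j i); ring.
    + rewrite !Ex_lsum, <- lsum_scal. apply lsum_le. intros i Hi.
      rewrite (Ex_scal M js (r I i) (LO i)), Ex_plus, (Ex_scal M js (r I i) (TH i)).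
      (* Resampling the seed of [i] on both sides reduces the claim to [resource_competitive] with
         the other seeds fixed. *)
      rewrite (Ex_resample M js i (LO i)), (Ex_resample M js i (TH i)),
        (Ex_resample M js i (LA i)) by auto.
      rewrite <- !Ex_scal, <- Ex_plus. apply Ex_le; auto. intros v.
      apply in_seq in Hi. apply resource_competitive; auto. lia.
  - apply Ex_le; auto. intros v. rewrite lsum_plus.
    apply Rle_trans with (lsum js (fun i => r I i * TH i v) +
      lsum (seq 0 (nT I)) (fun t => arrival_value g I alg v t)).
    + apply Rplus_le_compat_l. unfold LA.
      rewrite <- (run_lsum I js
        (fun i t j _ => if Nat.eqb j i then arrival_value g I alg v t else 0)).
      eapply Rle_trans; [|apply (run_arrivals_le I (arrival_value g I alg v) opt _ _ one zero v Hopt (Hlam v))].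
      eapply run_le; eauto. intros t j x Ht Hj HE Hx. right.
      apply (lsum_indic js j (fun _ => arrival_value g I alg v t) Hnd). apply in_seq; lia.
    + unfold TH, arrival_value.
      rewrite (lsum_ext js _ _ (fun i _ => eq_sym (run_scal I (r I i) (resource_share g I i) alg one zero v))).
      rewrite <- (run_lsum I js (fun i t j x => r I i * resource_share g I i t j x)).
      rewrite <- run_lsum, <- run_plus.
      eapply run_le; eauto. intros t j x Ht Hj HE Hx. right.
      unfold offer_share, reward.
      (* The shares of an offer, [p * r * g x] and [p * r * (1 - g x)], add up to its full
         reward. *)
      rewrite (lsum_indic _ t (fun _ => p I j t * r I j * g x)) by (apply seq_NoDup || (apply in_seq; lia)).
      rewrite (lsum_ext js _ (fun i => if Nat.eqb j i then r I i * (p I j t * (1 - g x)) else 0)).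
      2: { intros i _. unfold resource_share. destruct (Nat.eqb j i); ring. }
      rewrite (lsum_indic js j _ Hnd) by (apply in_seq; lia). ring.
Qed.

Lemma pmax_bounds I : 0 <= pmax I /\
  forall i t, (i < nI I)%nat -> (t < nT I)%nat -> E I i t = true -> p I i t <= pmax I.
Proof.
  unfold pmax. set (L := flat_map _ _).
  assert (HL : 0 <= fold_right Rmax 0 L /\ forall x, In x L -> x <= fold_right Rmax 0 L).
  { clearbody L. induction L as [|y L [IH0 IH]]; simpl; [split; [lra|tauto]|]. split.
    - eapply Rle_trans; [exact IH0|apply Rmax_r].
    - intros x [<-|Hx]; [apply Rmax_l|]. eapply Rle_trans; [apply IH, Hx|apply Rmax_r]. }
  destruct HL as [HL0 HL]. split; auto. intros i t Hi Ht HE. apply HL.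
  apply in_flat_map. exists i. split; [apply in_seq; lia|].
  apply in_map_iff. exists t. split; auto. apply filter_In. split; auto. apply in_seq; lia.
Qed.

Lemma pval_nonneg I pol done avail : wf_instance I -> valid I pol done avail -> 0 <= pval I pol.
Proof.
  intros [Hr Hp]. revert done avail.
  induction pol as [|t k IH|t i ks IHs kf IHf]; simpl; intros done avail Hv; [lra| |].
  - destruct Hv as (_ & _ & Hv). eauto.
  - destruct Hv as (Ht & _ & Hi & _ & HE & Hvs & Hvf).
    specialize (Hr i Hi). specialize (Hp i t Hi Ht HE).
    specialize (IHs _ _ Hvs). specialize (IHf _ _ Hvf).
    apply Rplus_le_le_0_compat; apply Rmult_le_pos; lra.
Qed.

Theorem theorem2 :
  exists C : R, 0 < C /\
  forall g : R -> R,
    (forall x, 0 <= x -> exists Ix,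
        improper_integral (fun y => exp (- y) / y) (x + 1) Ix /\
        g x = exp (x + 1) * Ix) ->
    g 0 > 596 / 1000 /\
    forall I : instance, wf_instance I ->
    forall v, alg_val g I 0 (fun _ => true) (fun _ => 0) v ->
    forall pol, valid I pol (fun _ => false) (fun _ => true) ->
      (1 - C * sqrt (pmax I)) * g 0 * pval I pol <= v.
Proof.
  exists 29. split; [lra|]. intros g Hg. change (is_scaling g) in Hg.
  split; [apply scaling_0_gt, Hg|].
  intros I Hwf v Hv pol Hpol.
  destruct (alg_val_greedy _ _ _ _ _ _ Hv) as (alg & Halg & <-).
  assert (Hg0 := scaling_0_gt g Hg). assert (Hopt0 := pval_nonneg _ _ _ _ Hwf Hpol).
  destruct (pmax_bounds I) as [Hpm0 Hpm]. set (pm := pmax I) in *.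
  assert (Hsq : sqrt pm * sqrt pm = pm) by (apply sqrt_sqrt, Hpm0).
  assert (Hsq0 := sqrt_pos pm).
  (* For small [pm] the loss [29 * pm] is at most [29 * sqrt pm]; otherwise [1 - 29 * sqrt pm] is
     not positive and the bound is trivial. *)
  destruct (Rle_dec (29 * pm) 1) as [Hsmall|Hbig].
  - apply Rle_trans with ((1 - 29 * pm) * g 0 * pval I pol).
    + rewrite !Rmult_assoc. apply Rmult_le_compat_r; [apply Rmult_le_pos; lra|].
      assert (sqrt pm <= 1) by nra. nra.
    + apply small_competitive; auto. split; [lra|]. intros i t Hi Ht HE.
      split; [apply Hwf; auto|apply Hpm; auto].
  - assert (Hneg : 1 - 29 * sqrt pm <= 0) by nra.
    apply Rle_trans with 0.
    + rewrite Rmult_assoc. assert (0 <= g 0 * pval I pol) by (apply Rmult_le_pos; lra). nra.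
    + eapply pval_nonneg; eauto. eapply greedy_valid; eauto. intros ? _. reflexivity.
Qed.
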